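(* Suppose $H$ is a non-elementary torsion-free hyperbolic group. For all $k\ge2$, $H$ contains a malnormal quasiconvex free subgroup $F$ of rank $k$.
   Context: ''Hyperbolic'' means Gromov-hyperbolic; non-elementary means not virtually cyclic. A subgroup $F\le H$ is malnormal when $g^{-1}Fg\cap F=\{1\}$ for all $g\in H\smallsetminus F$. *)

(* Defs.v *)
From HB Require Import structures.
From mathcomp Require Import all_boot all_order ssralg ssrnum rat.
From mathcomp Require Import boolp classical_sets functions cardinality.

Set Implicit Arguments.
Unset Strict Implicit.
Unset Printing Implicit Defensive.

Local Open Scope classical_set_scope.

(** * The free group on a set, as the group of reduced words *)

Section FreeGroup.
Variable T : choiceType.

(* The letter (t, false) stands for the generator t, (t, true) for its
   inverse. *)
Definition inv_letter (a : T * bool) : T * bool := (a.1, ~~ a.2).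

Definition reduced : pred (seq (T * bool)) :=
  sorted [rel a b | b != inv_letter a].

Definition push_letter (a : T * bool) (w : seq (T * bool)) :=
  if w is b :: w' then if b == inv_letter a then w' else a :: w else [:: a].

Definition reduce (w : seq (T * bool)) := foldr push_letter [::] w.

Definition inv_word (w : seq (T * bool)) := rev (map inv_letter w).

Lemma inv_letterK : involutive inv_letter.
Proof. by case=> t b; rewrite /inv_letter /= negbK. Qed.

Lemma reduced_push a w : reduced w -> reduced (push_letter a w).
Proof.
case: w => //= b w; case: ifP => [_|/negbT ab] pw; first exact: path_sorted pw.
by rewrite /reduced /= ab.
Qed.

Lemma reduced_foldr u w : reduced w -> reduced (foldr push_letter w u).
Proof. by move=> rw; elim: u => //= a u; apply: reduced_push. Qed.

Lemma push_letterK a w :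
  reduced w -> push_letter a (push_letter (inv_letter a) w) = w.
Proof.
case: w => [|b w] /=; first by rewrite eqxx.
rewrite inv_letterK; case: eqP => [->|_ _ /=]; last by rewrite eqxx.
by case: w => [|c w] //= /andP[/negbTE->].
Qed.

Lemma foldr_push a u w : reduced w ->
  foldr push_letter w (push_letter a u) = push_letter a (foldr push_letter w u).
Proof.
move=> rw; case: u => [|b u] //=; case: ifP => [/eqP->|_] //=.
by rewrite push_letterK // reduced_foldr.
Qed.

Lemma foldr_reduce u w : reduced w ->
  foldr push_letter w (reduce u) = foldr push_letter w u.
Proof. by move=> rw; elim: u => //= a u IHu; rewrite foldr_push // IHu. Qed.

Lemma reduce_id w : reduced w -> reduce w = w.
Proof.
elim: w => //= a w IHw raw; rewrite /reduce /= -/(reduce w).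
rewrite IHw; last exact: path_sorted raw.
by case: w raw {IHw} => //= b w /andP[/negbTE->].
Qed.

Lemma reduced_inv_word w : reduced w -> reduced (inv_word w).
Proof.
rewrite /reduced /inv_word rev_sorted sorted_map; apply: sub_sorted => a b /=.
by apply: contra => /eqP->; rewrite !inv_letterK.
Qed.

Lemma inv_wordK : involutive inv_word.
Proof.
move=> w; rewrite /inv_word map_rev revK -map_comp -[RHS]map_id.
by apply: eq_map => a /=; apply: inv_letterK.
Qed.

Lemma foldr_inv_word w : foldr push_letter w (inv_word w) = [::].
Proof.
elim: w => //= a w IHw; rewrite /inv_word /= rev_cons -cats1 foldr_cat /=.
by rewrite inv_letterK eqxx.
Qed.

Record free_group := FreeGroup {
  word_of :> seq (T * bool);
  word_ofP : reduced word_of }.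

HB.instance Definition _ := [isSub for word_of].
HB.instance Definition _ := [Choice of free_group by <:].

Definition free_one : free_group := @FreeGroup [::] isT.
Definition free_mul (u v : free_group) : free_group :=
  FreeGroup (reduced_foldr (u ++ v) (isT : reduced [::])).
Definition free_inv (u : free_group) : free_group :=
  FreeGroup (reduced_inv_word (word_ofP u)).

Lemma free_mulE u v : word_of (free_mul u v) = foldr push_letter v u.
Proof. by rewrite /= foldr_cat -/(reduce v) reduce_id // word_ofP. Qed.

Lemma free_mulA : associative free_mul.
Proof.
move=> u v w; apply: val_inj; change val with word_of; rewrite !free_mulE.
have -> : foldr push_letter v u = reduce (u ++ v) by rewrite -free_mulE.
by rewrite foldr_reduce ?word_ofP // foldr_cat.
Qed.

Lemma free_mul1 : left_id free_one free_mul.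
Proof. by move=> u; apply: val_inj; change val with word_of; rewrite free_mulE. Qed.

Lemma free_mulr1 : right_id free_one free_mul.
Proof.
by move=> u; apply: val_inj; rewrite /= cats0 -/(reduce u) reduce_id // word_ofP.
Qed.

Lemma free_mulV : left_inverse free_one free_inv free_mul.
Proof.
move=> u; apply: val_inj; change val with word_of.
by rewrite free_mulE /= foldr_inv_word.
Qed.

Lemma free_mulrV : right_inverse free_one free_inv free_mul.
Proof.
move=> u; have {1}-> : u = free_inv (free_inv u) by apply: val_inj; rewrite /= inv_wordK.
exact: free_mulV.
Qed.

HB.instance Definition _ := isGroup.Build free_group
  free_mulA free_mul1 free_mulr1 free_mulV free_mulrV.

End FreeGroup.

(** * Subgroups *)

Section Subgroups.
Variable H : groupType.
Implicit Types (F C : set H) (S : seq H).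

Definition subgroup F : Prop := group_closed (mem F).

Definition generated (A : set H) : set H := smallest subgroup A.

Definition cyclic C : Prop := exists x, C = generated [set x].

Definition finite_index C : Prop :=
  finite_set [set [set (g * c)%g | c in C] | g in [set: H]].

Definition virtually_cyclic : Prop := exists C, cyclic C /\ finite_index C.

Definition torsion_free : Prop :=
  forall (x : H) (n : nat), 0 < n -> (x ^+ n = 1)%g -> x = 1%g.

(* (x ^ g)%g is the conjugate g^-1 * x * g. *)
Definition malnormal F : Prop :=
  forall g, ~ F g -> [set (x ^ g)%g | x in F] `&` F = [set 1%g].

Definition free_of_rank F (k : nat) : Prop :=
  exists phi : {multiplicative free_group 'I_k -> H},
    injective phi /\ range phi = F.

(** * Cayley graphs and word metrics *)

Definition generating S : Prop := generated [set` S] = [set: H].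

Definition cayley_edge S : rel H :=
  [rel x y | ((x^-1 * y)%g \in S) || ((y^-1 * x)%g \in S)].

(* [x :: p] is the list of vertices of an edge path of length [size p]. *)
Definition cayley_path S (x y : H) (p : seq H) : Prop :=
  path (cayley_edge S) x p /\ last x p = y.

(* The value 0 for vertices that no path connects is a dummy: it does not occur
   when S is generating. *)
Definition word_dist S (x y : H) : nat :=
  if pselect (exists n, `[< exists2 p, cayley_path S x y p & size p = n >])
    is left ex then ex_minn ex else 0.

Definition geodesic S (x y : H) (p : seq H) : Prop :=
  cayley_path S x y p /\ size p = word_dist S x y.

Definition quasiconvex_wrt S F : Prop :=
  exists K : nat, forall x y p, F x -> F y -> geodesic S x y p ->
    forall z, z \in x :: p -> exists2 f, F f & word_dist S z f <= K.

(* In a hyperbolic group this property does not depend on the generating set;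
   hyperbolicity itself, below, is likewise independent of it. *)
Definition quasiconvex F : Prop :=
  forall S, generating S -> quasiconvex_wrt S F.

End Subgroups.

(** * Gromov hyperbolicity *)

Definition gromov_product (X : Type) (d : X -> X -> nat) (w x y : X) : rat :=
  (((d x w)%:R + (d y w)%:R - (d x y)%:R) / 2%:R)%R.

Definition gromov_hyperbolic (X : Type) (d : X -> X -> nat) : Prop :=
  exists delta : rat, forall w x y z,
    (Num.min (gromov_product d w x y) (gromov_product d w y z) - delta
       <= gromov_product d w x z)%R.

Definition hyperbolic_group (H : groupType) : Prop :=
  exists S : seq H, generating S /\ gromov_hyperbolic (word_dist S).

Definition non_elementary (H : groupType) : Prop := ~ virtually_cyclic H.

(* Main.v *)
(** Twice the Gromov product is a natural number, and everything is deduced from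
    the four-point inequality through the local-to-global principle: a chain of
    long steps with small Gromov products at its vertices is quasi-geodesic.

    Some [g] has a quasi-geodesic orbit, and its commensurator E(g) is malnormal
    and stays near the axis of [g]; as [H] is not virtually cyclic, there is [x]
    outside E(g). The axes of distinct cosets of E(g) have bounded overlap, so
    products alternating [x] or its inverse with long powers of [g] trace
    quasi-geodesic broken lines. [F] is generated by the elements
    [g ^ theta(a) * x * g ^ - theta(a^-1)], where [theta] is an injection of the
    letters [a] into a sparse Sidon set. It is free, since merging the powers of
    [g] in a reduced word leaves long powers only. If [y] conjugates an element
    of [F] to another one, the broken lines of high powers of the two elements
    fellow-travel, so their pieces lie in the same cosets of E(g); malnormality
    of E(g) and torsion-freeness then force the lines to share two consecutive
    vertices, and the Sidon property identifies a letter, hence a vertex of [F]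
    with a vertex of [y F]. Quasiconvexity for every generating set follows as
    nearest-point projections to [F] are contracting. *)

Require Import Defs.
From HB Require Import structures.
From mathcomp Require Import all_boot all_order ssralg ssrnum ssrint rat archimedean.
From mathcomp Require Import boolp classical_sets cardinality zify lra.

Set Implicit Arguments.
Unset Strict Implicit.
Unset Printing Implicit Defensive.

Import Order.TTheory GRing.Theory Num.Theory.
Local Open Scope group_scope.

Lemma nat_ivt (f : nat -> nat) r n : f 0 <= r -> r < f n ->
  exists2 i, i < n & f i <= r < f i.+1.
Proof.
move=> f0; elim: n => [|n IHn] fn; first by lia.
have [rn|rn] := ltnP r (f n).
  by have [i ilt ri] := IHn rn; exists i => //; apply: ltnW.
by exists n => //; rewrite rn fn.
Qed.

(** Up to the final change of generating set, the geometry uses only these properties: [hm_mid]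
    stands for geodesics, and [hm_hyp] is the four-point form of hyperbolicity, with no base point
    and no halves. *)
Record hyperbolic_metric (H : groupType) (d : H -> H -> nat) (dl : nat) : Prop :=
  HyperbolicMetric {
  hm_refl x : d x x = 0;
  hm_sym x y : d x y = d y x;
  hm_tri y x z : d x z <= d x y + d y z;
  hm_mul g x y : d (g * x) (g * y) = d x y;
  hm_mid x y r : r <= d x y -> exists2 z, d x z = r & d z y = d x y - r;
  hm_proper R : exists s : seq H, forall x, d 1 x <= R -> x \in s;
  hm_hyp x y z w :
    d x z + d y w <= maxn (d x y + d z w) (d x w + d y z) + dl }.

(** * Word metrics *)

Section WordMetric.
Variables (H : groupType) (S : seq H).
Hypothesis genS : generating S.
Implicit Types x y z : H.
Notation d := (word_dist S).

Lemma cayley_edge_sym x y : cayley_edge S x y = cayley_edge S y x.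
Proof. exact: orbC. Qed.

Lemma cayley_edge_mul g x y : cayley_edge S (g * x) (g * y) = cayley_edge S x y.
Proof. by rewrite /cayley_edge /= !invgM -!mulgA !mulKg. Qed.

Lemma cayley_path_mul g x y p : cayley_path S x y p ->
  cayley_path S (g * x) (g * y) [seq g * z | z <- p].
Proof.
move=> [pp <-]; split; last exact: last_map.
rewrite path_map; rewrite (eq_path (e' := cayley_edge S)) // => u v.
exact: cayley_edge_mul.
Qed.

Lemma cayley_path_cat x y z p q :
  cayley_path S x y p -> cayley_path S y z q -> cayley_path S x z (p ++ q).
Proof. by move=> [pp <-] [pq <-]; split; rewrite ?last_cat // cat_path pp. Qed.

Lemma cayley_path_rev x y p : cayley_path S x y p ->
  exists2 q, cayley_path S y x q & size q = size p.
Proof.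
move=> [pp <-]; exists (rev (belast x p)); last by rewrite size_rev size_belast.
split; first by rewrite rev_path (eq_path (e' := cayley_edge S)) // => u v; exact: cayley_edge_sym.
by case: p {pp} => //= u p; rewrite rev_cons last_rcons.
Qed.

(** The vertices that paths from 1 reach form a subgroup containing [S]. *)
Lemma cayley_connected x y : exists p, cayley_path S x y p.
Proof.
suff /(_ (x^-1 * y)) [p pp] : forall z, exists p, cayley_path S 1 z p.
  by exists [seq x * z | z <- p]; have := cayley_path_mul x pp; rewrite mulg1 mulVKg.
move=> z; have : [set: H]%classic z by [].
rewrite -genS => /(_ [set z | exists p, cayley_path S 1 z p]%classic); apply; split.
  split; first by rewrite inE; exists [::].
  move=> u v; rewrite !inE => -[p pu] [q qv].
  have [q' q'v _] := cayley_path_rev qv.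
  exists (p ++ [seq u / v * z | z <- q']); apply: (cayley_path_cat pu).
  by have := cayley_path_mul (u / v) q'v; rewrite mulg1 mulgVK.
by move=> s /= sS; exists [:: s]; split; rewrite // /cayley_edge /= invg1 mul1g sS.
Qed.

Lemma word_dist_le x y p : cayley_path S x y p -> d x y <= size p.
Proof.
move=> pp; rewrite /word_dist; case: pselect => // ex.
case: ex_minnP => m _; apply; apply/asboolP; by exists p.
Qed.

Lemma word_distP x y : exists2 p, cayley_path S x y p & size p = d x y.
Proof.
have [p pp] := cayley_connected x y; rewrite /word_dist; case: pselect => [ex|[]].
  by case: ex_minnP => m /asboolP [q qq <-] _; exists q.
by exists (size p); apply/asboolP; exists p.
Qed.

Lemma word_dist_refl x : d x x = 0.
Proof. by have /word_dist_le : cayley_path S x x [::] by []; rewrite leqn0 => /eqP. Qed.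

Lemma word_dist_eq x y : d x y = 0 -> x = y.
Proof. by move=> d0; have [p [_ lp]] := word_distP x y; rewrite d0 -lp => /size0nil->. Qed.

Lemma word_dist_sym x y : d x y = d y x.
Proof.
suff le u v : d u v <= d v u by apply/eqP; rewrite eqn_leq !le.
by have [p /cayley_path_rev[q /word_dist_le qd <-] <-] := word_distP v u.
Qed.

Lemma word_dist_tri y x z : d x z <= d x y + d y z.
Proof.
have [p pp <-] := word_distP x y; have [q qq <-] := word_distP y z.
by rewrite -size_cat; apply/word_dist_le/(cayley_path_cat pp).
Qed.

Lemma word_dist_mul g x y : d (g * x) (g * y) = d x y.
Proof.
have le h u v : d (h * u) (h * v) <= d u v.
  have [p pp <-] := word_distP u v.
  by rewrite -(size_map (fun z => h * z)); apply/word_dist_le/cayley_path_mul.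
by apply/eqP; rewrite eqn_leq le /=; have := le g^-1 (g * x) (g * y); rewrite !mulKg.
Qed.

Lemma cayley_path_take x y p i : cayley_path S x y p ->
  cayley_path S x (nth x (x :: p) (minn i (size p))) (take i p) /\
  cayley_path S (nth x (x :: p) (minn i (size p))) y (drop i p).
Proof.
move=> [pp <-].
have e : nth x (x :: p) (minn i (size p)) = last x (take i p).
  rewrite (last_nth x) size_take_min -[x :: take i p]/(take i.+1 (x :: p)).
  by rewrite nth_take // ltnS geq_minl.
move: pp; rewrite -{1}(cat_take_drop i p) cat_path e => /andP[p1 p2].
by split; split => //; rewrite -last_cat cat_take_drop.
Qed.

Lemma geodesic_nth x y p i : geodesic S x y p -> i <= size p ->
  d x (nth x (x :: p) i) = i /\ d (nth x (x :: p) i) y = size p - i.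
Proof.
move=> [pp sp] ip; have [] := cayley_path_take i pp.
rewrite (minn_idPl ip) => /word_dist_le d1 /word_dist_le d2.
have := word_dist_tri (nth x (x :: p) i) x y.
rewrite size_take_min (minn_idPl ip) in d1; rewrite size_drop in d2.
lia.
Qed.

Lemma geodesic_exists x y : exists p, geodesic S x y p.
Proof. by have [p pp sp] := word_distP x y; exists p. Qed.

Lemma word_dist_mid x y r : r <= d x y ->
  exists2 z, d x z = r & d z y = d x y - r.
Proof.
move=> rd; have [p gp] := geodesic_exists x y.
have rp : r <= size p by case: gp => _ ->.
have [d1 d2] := geodesic_nth gp rp.
by exists (nth x (x :: p) r) => //; case: gp => _ <-.
Qed.

Lemma word_ball_finite R : exists s : seq H, forall x, d 1 x <= R -> x \in s.
Proof.
elim: R => [|R [s IHs]].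
  by exists [:: 1] => x; rewrite leqn0 => /eqP /word_dist_eq <-; rewrite inE.
pose T := S ++ [seq u^-1 | u <- S].
exists (s ++ [seq u * v | u <- s, v <- T]) => x dx; rewrite mem_cat.
have [/IHs-> //|dx'] := leqP (d 1 x) R.
have Rx : R <= d 1 x by apply: ltnW.
have [z d1z dzx] := word_dist_mid Rx.
have [p [pp lp] sp] := word_distP z x.
have {dzx dx dx'} : size p = 1%N by lia.
case: p pp lp {sp} => [|u [|//]] //= /andP[e _] ux _; rewrite {}ux in e.
apply/orP; right; apply/allpairsP; exists (z, z^-1 * x) => /=; split.
- by apply: IHs; rewrite d1z.
- rewrite mem_cat; case/orP: e => [-> //|e]; apply/orP; right.
  by apply/mapP; exists (x^-1 * z) => //; rewrite invgM invgK.
- by rewrite mulVKg.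
Qed.

End WordMetric.

Lemma word_lipschitz (H : groupType) (S T : seq H) :
  generating S -> generating T ->
  exists la, forall x y, word_dist T x y <= la * word_dist S x y.
Proof.
move=> genS genT; pose la := \max_(s <- S) word_dist T 1 s; exists la => x y.
have [p [pp <-] <-] := word_distP genS x y.
elim: p x pp => [|u p IHp] x /=; first by rewrite word_dist_refl.
case/andP=> e pp; apply: leq_trans (word_dist_tri genT u _ _) _.
rewrite mulnS leq_add ?IHp //.
have la_ge s : s \in S -> word_dist T 1 s <= la.
  by move=> sS; rewrite /la (big_rem s) //= leq_maxl.
case/orP: e => /la_ge; first by rewrite -(word_dist_mul genT x) mulg1 mulVKg.
by rewrite -(word_dist_mul genT u) mulg1 mulVKg word_dist_sym.
Qed.

Lemma word_hyperbolic (H : groupType) (S : seq H) :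
  generating S -> gromov_hyperbolic (word_dist S) ->
  exists dl, hyperbolic_metric (word_dist S) dl.
Proof.
move=> genS [dq hq].
(* [dl] rounds [2 * dq] up, as doubling clears the halves in the Gromov products. *)
have [dl dlP] : exists dl : nat, (2%:R * dq <= dl%:R)%R.
  exists (Num.truncn (2%:R * dq)).+1; exact/ltW/real_truncnS_gt/num_real.
exists dl; split.
- exact: word_dist_refl.
- exact: word_dist_sym.
- exact: word_dist_tri.
- exact: word_dist_mul.
- exact: word_dist_mid.
- exact: word_ball_finite.
move=> x y z w; have := hq w x y z; rewrite /gromov_product.
set a := word_dist S x w; set b := word_dist S y w; set c := word_dist S z w.
set e := word_dist S x y; set f := word_dist S y z; set h := word_dist S x z.
move=> hq'.
have : ((h + b)%:R <= (e + c)%:R + dl%:R :> rat)%R \/ ((h + b)%:R <= (a + f)%:R + dl%:R :> rat)%R.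
  move: hq'; rewrite /Order.min; case: ifP => _ hq'; [left|right]; rewrite !natrD; lra.
by rewrite -!natrD !ler_nat; lia.
Qed.

(** * Chains in hyperbolic metrics *)

Section HyperbolicGeometry.
Variables (H : groupType) (d : H -> H -> nat) (dl : nat).
Hypothesis hm : hyperbolic_metric d dl.
Implicit Types a b x y z : H.

(* [z] lies within [C / 2] of being on a geodesic from [a] to [b]: twice the
   Gromov product of [a] and [b] at [z] is at most [C]. *)
Definition btw C a z b := d a z + d z b <= d a b + C.

Lemma btwC C a z b : btw C a z b = btw C b z a.
Proof. by rewrite /btw addnC !(hm_sym hm b) (hm_sym hm a z). Qed.

Lemma btw_mono C D a z b : C <= D -> btw C a z b -> btw D a z b.
Proof. rewrite /btw; lia. Qed.

Lemma btw_mul C g a z b : btw C (g * a) (g * z) (g * b) = btw C a z b.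
Proof. by rewrite /btw !(hm_mul hm). Qed.

Lemma btw_mul1 C g z b : btw C g (g * z) (g * b) = btw C 1 z b.
Proof. by rewrite -(btw_mul C g 1) mulg1. Qed.

Lemma btw_move C A a z b z' : d z z' <= A -> btw C a z b -> btw (C + 2 * A) a z' b.
Proof.
rewrite /btw => zA.
have := hm_tri hm z a z'; have := hm_tri hm z z' b; rewrite (hm_sym hm z' z).
lia.
Qed.

(** The cost is [dl] however large [A] is: as [z] is far from [a], the term of the maximum
    containing [d a a'] is too small to matter in the four-point inequality. *)
Lemma btw_far C A a z b a' : d a a' <= A -> 2 * A + C + dl < 2 * d a z ->
  btw C a z b -> btw (C + dl) a' z b.
Proof.
rewrite /btw => aA far.
have := hm_hyp hm a a' b z; have := hm_tri hm a' a z; rewrite (hm_sym hm b z).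
lia.
Qed.

Lemma btw_far2 C A a z b a' b' : d a a' <= A -> d b b' <= A ->
  2 * A + C + 2 * dl < 2 * d a z -> 2 * A + C + 2 * dl < 2 * d z b ->
  btw C a z b -> btw (C + 2 * dl) a' z b'.
Proof.
move=> aA bA fa fb ab.
have : btw (C + dl) a' z b by apply: (btw_far aA) ab; lia.
rewrite btwC => /(btw_far bA) ba; rewrite btwC mul2n -addnn addnA.
by apply: ba; rewrite (hm_sym hm b); lia.
Qed.

Lemma btw_line K o z a b : btw K o a z -> btw K o b z ->
  d o a <= d o b -> d a b + d o a <= d o b + K + dl.
Proof.
rewrite /btw => ha hb oab.
by have := hm_hyp hm o a z b; rewrite (hm_sym hm b z) in hb *; lia.
Qed.

(** Some step of the chain crosses the distance from [v 0] to [z]; by [btw_line], its starting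
    vertex is close to [z]. *)
Lemma near_chain K D (v : nat -> H) n z :
  (forall i, i < n -> d (v i) (v i.+1) <= D) ->
  (forall i, i <= n -> btw K (v 0) (v i) (v n)) ->
  btw K (v 0) z (v n) ->
  exists2 i, i <= n & d z (v i) <= D + K + dl.
Proof.
move=> vD vK zK.
have [zn|nz] := ltnP (d (v 0) z) (d (v 0) (v n)).
  have z0 : d (v 0) (v 0) <= d (v 0) z by rewrite (hm_refl hm).
  have [i ilt /andP[iz zi]] := nat_ivt (f := fun i => d (v 0) (v i)) z0 zn.
  exists i; first exact: ltnW.
  have := btw_line (vK _ (ltnW ilt)) zK iz; rewrite (hm_sym hm _ z).
  have := hm_tri hm (v i) (v 0) (v i.+1); have := vD _ ilt; lia.
exists n => //; move: zK; rewrite /btw; lia.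
Qed.

Section Chain.
Variables (C L n : nat) (v : nat -> H).
Hypothesis vC : forall i, i.+1 < n -> btw C (v i) (v i.+1) (v i.+2).
Hypothesis vL : forall i, i < n -> L <= d (v i) (v i.+1).
Hypothesis CL : C + 2 * dl < L.

(** Local-to-global principle: in the four-point inequality for [v 0] and three consecutive
    vertices, the length of the step from [v i] to [v i.+1] excludes one term of the maximum. *)
Lemma chain_fwd i : i < n -> btw (C + dl) (v 0) (v i) (v i.+1).
Proof.
elim: i => [|i IHi] ilt; first by rewrite /btw (hm_refl hm); lia.
have := IHi (ltnW ilt); have := vC ilt; have := vL (ltnW ilt); rewrite /btw.
have := hm_hyp hm (v 0) (v i) (v i.+1) (v i.+2); lia.
Qed.

Lemma chain_step i : i < n ->
  d (v 0) (v i) + d (v i) (v i.+1) <= d (v 0) (v i.+1) + C + dl.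
Proof. by move=> /chain_fwd; rewrite /btw; lia. Qed.

Lemma chain_growth i : i <= n -> i <= d (v 0) (v i).
Proof.
elim: i => // i IHi ilt; have := IHi (ltnW ilt); have := chain_step ilt.
have := vL ilt; lia.
Qed.

End Chain.

(** [chain_fwd], applied to the chain and to its reverse, controls both sides of the step from [v i]
    to [v i.+1]; one more four-point inequality glues them. *)
Lemma chain_btw C L n (v : nat -> H) :
  (forall i, i.+1 < n -> btw C (v i) (v i.+1) (v i.+2)) ->
  (forall i, i < n -> L <= d (v i) (v i.+1)) -> C + 2 * dl < L ->
  forall i, i <= n -> btw (C + 2 * dl) (v 0) (v i) (v n).
Proof.
move=> vC vL CL i.
rewrite leq_eqVlt => /orP[/eqP->|ilt]; first by rewrite /btw (hm_refl hm); lia.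
pose w j := v (n - j).
have wC j : j.+1 < n -> btw C (w j) (w j.+1) (w j.+2).
  move=> jlt; rewrite /w btwC.
  have e1 : (n - j.+2).+1 = n - j.+1 by lia.
  have e2 : (n - j.+1).+1 = n - j by lia.
  by have := @vC (n - j.+2); rewrite e1 e2; apply; lia.
have wL j : j < n -> L <= d (w j) (w j.+1).
  move=> jlt; rewrite /w (hm_sym hm).
  have e1 : (n - j.+1).+1 = n - j by lia.
  by have := @vL (n - j.+1); rewrite e1; apply; lia.
have := chain_fwd wC wL CL (i := n - i.+1).
have := chain_fwd vC vL CL ilt; rewrite /btw /w subn0.
have -> : n - (n - i.+1) = i.+1 by lia.
have -> : n - (n - i.+1).+1 = i by lia.
have := hm_hyp hm (v 0) (v i) (v i.+1) (v n).
rewrite !(hm_sym hm (v n)) (hm_sym hm (v i.+1) (v i)).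
have := vL _ ilt; lia.
Qed.

Lemma hm_inv x : d 1 x^-1 = d 1 x.
Proof. by rewrite -(hm_mul hm x) mulg1 mulgV (hm_sym hm). Qed.

Lemma hm_len x y : d x y = d 1 (x^-1 * y).
Proof. by rewrite -(hm_mul hm x^-1) mulVg. Qed.

Lemma hm_mulr x y : d x (x * y) = d 1 y.
Proof. by rewrite hm_len mulKg. Qed.

Lemma hm_pigeon R : exists N, forall f : nat -> H,
  (forall i, i <= N -> d 1 (f i) <= R) -> exists i j, i < j <= N /\ f i = f j.
Proof.
have [s Hs] := hm_proper hm R; exists (size s) => f fR.
have sub : {subset [seq f i | i <- iota 0 (size s).+1] <= s}.
  move=> x /mapP[i]; rewrite mem_iota add0n ltnS => /andP[_ ilt] ->.
  exact/Hs/fR.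
have [u|/(uniqPn 1)] := boolP (uniq [seq f i | i <- iota 0 (size s).+1]).
  by have := uniq_leq_size u sub; rewrite size_map size_iota ltnn.
rewrite size_map size_iota => -[i [j [ij jlt]]].
rewrite !(nth_map 0) ?size_iota ?(ltn_trans ij) // !nth_iota ?(ltn_trans ij) //.
by move=> e; exists i, j; rewrite ij -ltnS jlt.
Qed.

(** Quasiconvexity in terms of distances alone: [F] has points at every stage of a geodesic between
    two of its points, up to [D]. *)
Definition coarsely_convex (F : set H) := exists D, forall f f' r,
  F f -> F f' -> r <= d f f' ->
  exists p, [/\ F p, d f p <= r + D, r <= d f p + D & btw D f p f'].

End HyperbolicGeometry.

(** * Integer powers in a group *)

Section IntegerPowers.
Variable H : groupType.
Implicit Types g x : H.

Definition gexpz g (m : int) : H :=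
  match m with Posz n => g ^+ n | Negz n => (g ^+ n.+1)^-1 end.

Lemma gexpz0 g : gexpz g 0 = 1. Proof. by []. Qed.
Lemma gexpzS g m : gexpz g (m + 1)%R = gexpz g m * g.
Proof.
case: m => [m|[|m]]; first by rewrite -PoszD addn1 /= expgSr.
  by rewrite /= mulVg.
have -> : (Negz m.+1 + 1)%R = Negz m by lia.
by rewrite /= [g ^+ m.+2]expgS invgM mulgVK.
Qed.

Lemma gexpzDn g m n : gexpz g (m + Posz n)%R = gexpz g m * g ^+ n.
Proof.
elim: n => [|n IHn]; first by rewrite addr0 mulg1.
have -> : (m + Posz n.+1 = m + Posz n + 1)%R by lia.
by rewrite gexpzS IHn -mulgA -expgSr.
Qed.

Lemma gexpzD g m n : gexpz g (m + n)%R = gexpz g m * gexpz g n.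
Proof.
case: n => n; first exact: gexpzDn.
apply: (mulIg (g ^+ n.+1)); rewrite -gexpzDn mulgVK.
by congr gexpz; lia.
Qed.

Lemma gexpzN g m : gexpz g (- m)%R = (gexpz g m)^-1.
Proof. by apply/esym/mulg1_eq; rewrite -gexpzD subrr. Qed.

Lemma gexpzB g m n : gexpz g (m - n)%R = gexpz g m / gexpz g n.
Proof. by rewrite gexpzD gexpzN. Qed.

Lemma gexpzMn g m n : gexpz g (m * Posz n)%R = gexpz g m ^+ n.
Proof.
elim: n => [|n IHn]; first by rewrite mulr0.
have -> : (m * Posz n.+1 = m * Posz n + m)%R by lia.
by rewrite gexpzD IHn expgSr.
Qed.

Lemma gexpzM g m n : gexpz g (m * n)%R = gexpz (gexpz g m) n.
Proof.
case: n => n; first exact: gexpzMn.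
have -> : (m * Negz n = - (m * Posz n.+1))%R by lia.
by rewrite gexpzN gexpzMn.
Qed.

Lemma gexpz_conj g h x : g * x = x * h ->
  forall m, gexpz g m * x = x * gexpz h m.
Proof.
move=> e; have en n : g ^+ n * x = x * h ^+ n.
  elim: n => [|n IHn]; first by rewrite mul1g mulg1.
  by rewrite !expgS -mulgA IHn mulgA e mulgA.
case=> n; first exact: en.
apply: (mulgI (g ^+ n.+1)); apply: (mulIg (h ^+ n.+1)).
by rewrite mulVKg -[RHS]mulgA mulgVK en.
Qed.

End IntegerPowers.

(** * Loxodromic elements and their commensurators *)

Section Loxodromic.
Variables (H : groupType) (d : H -> H -> nat) (dl : nat).
Hypothesis hm : hyperbolic_metric d dl.
Implicit Types g h x : H.

Lemma torsion_free_expg_inj h : torsion_free H -> h <> 1 ->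
  injective (fun n => h ^+ n).
Proof.
move=> tf h1 m n; wlog mn : m n / m <= n => [hw e|/= e].
  by have [/hw|/ltnW/hw] := leqP m n; [apply|move/(_ (esym e))].
apply/eqP; rewrite eqn_leq mn /= leqNgt; apply/negP => mltn; apply: h1.
apply: (tf h (n - m)); first by rewrite subn_gt0.
by rewrite expgnFr // e mulgV.
Qed.

Lemma expg_unbounded h R : injective (fun n => h ^+ n) ->
  exists n, R < d 1 (h ^+ n).
Proof.
move=> hI; have [N HN] := hm_pigeon hm R.
apply: contrapT => no; have [|i [j [ij /hI]]] := HN (fun n => h ^+ n).
  by move=> i _; rewrite leqNgt; apply/negP => lt; apply: no; exists i.
by lia.
Qed.

(* On a long geodesic from 1 to [h ^+ M], the powers [h ^+ n] with [n] bounded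
   almost act as translations; far from the ends, one of them moves a point [p]
   by more than [rho], since otherwise the conjugates of [h ^+ n] by [p] would
   all lie in one ball. *)
Lemma loxodromic_exists h rho : injective (fun n => h ^+ n) ->
  exists2 g, rho < d 1 g & btw d (7 * dl) 1 g (g ^+ 2).
Proof.
move=> hI; have [N HN] := hm_pigeon hm rho.
have [A HA] : exists A, forall n, n <= 2 * N -> d 1 (h ^+ n) <= A.
  exists (\max_(i < (2 * N).+1) d 1 (h ^+ i)) => n; rewrite -ltnS => nN.
  exact: (leq_bigmax (Ordinal nN)).
(* [r] keeps [p] so far from 1 and from [q] that moving these ends by at most [A] costs only
   [2 * dl]. *)
have [r Hr] : exists r, r = A + 2 * dl + 1 by exists (A + 2 * dl + 1).
have [q HM comm] : exists2 q, 10 * r < d 1 q & forall n, h ^+ n * q = q * h ^+ n.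
  have [M HM] := expg_unbounded (10 * r) hI.
  by exists (h ^+ M) => // n; rewrite -!expgnDr addnC.
have rq : r <= d 1 q by lia.
have [p d1p dpq] := hm_mid hm rq.
have onp n : n <= 2 * N -> btw d (2 * dl) 1 (h ^+ n * p) q.
  move=> /HA nA.
  have := @btw_far2 _ _ _ hm 0 A (h ^+ n) (h ^+ n * p) (h ^+ n * q) 1 q.
  rewrite !(hm_mul hm) add0n; apply.
  - by rewrite (hm_sym hm).
  - by rewrite comm (hm_sym hm) (hm_mulr hm).
  - by rewrite (hm_mulr hm); lia.
  - lia.
  - by rewrite (btw_mul1 hm) /btw; lia.
have [n nN pn] : exists2 n, n <= N & rho < d p (h ^+ n * p).
  apply: contrapT => no; have [|i [j [ij]]] := HN (fun n => p^-1 * (h ^+ n * p)).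
    move=> i iN; rewrite -(hm_len hm) leqNgt; apply/negP => lt.
    by apply: no; exists i.
  by move=> /mulgI/mulIg/hI; lia.
exists (p^-1 * (h ^+ n * p)); first by rewrite -(hm_len hm).
have -> : (p^-1 * (h ^+ n * p)) ^+ 2 = p^-1 * (h ^+ (n + n) * p).
  by rewrite expg2 expgnDr !mulgA mulgK.
rewrite -(btw_mul hm _ p) mulg1 !mulVKg.
have o0 : btw d (2 * dl) q p 1.
  by rewrite (btwC hm); have := onp 0 isT; rewrite expg0 mul1g.
have o1 : btw d (2 * dl) q (h ^+ n * p) 1 by rewrite (btwC hm); apply: onp; lia.
set p1 := h ^+ n * p in pn o1 *.
have e2 : h ^+ (n + n) * p = h ^+ n * p1 by rewrite expgnDr mulgA.
rewrite e2; set p2 := h ^+ n * p1.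
pose q' := (h ^+ n)^-1 * q.
have l12 : d p1 p2 = d p p1 by rewrite (hm_mul hm).
have e1 : d p1 q = d p q' by rewrite -(hm_mul hm (h ^+ n) p) mulVKg.
have e3 : d p2 q = d p1 q' by rewrite -(hm_mul hm (h ^+ n) p1) mulVKg.
have qq' : d q q' <= A.
  rewrite (hm_sym hm) -(hm_mul hm (h ^+ n)) mulVKg comm (hm_mulr hm).
  by apply: HA; lia.
have dp1 : d 1 p1 <= A + r.
  apply: leq_trans (hm_tri hm (h ^+ n) _ _) _; rewrite leq_add ?HA ?(hm_mulr hm); lia.
have t1 := hm_tri hm 1 p p1; rewrite (hm_sym hm p 1) in t1.
have t2 := hm_tri hm p1 p q.
(* Seen from the far points [q] and [q'], the steps from [p] to [p1] and from [p1] to [p2] make the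
   same progress up to [dl], so the second does not undo the first. *)
have h1 := hm_hyp hm p p1 q q'; have h2 := hm_hyp hm p p1 q' q.
rewrite (hm_sym hm q' q) in h2.
have t3 := hm_tri hm p2 p q; have t4 := hm_tri hm p p2 q.
rewrite (hm_sym hm p2 p) in t4.
have b1 := btw_line hm o0 o1; have b2 := btw_line hm o1 o0.
rewrite (hm_sym hm p1 p) !(hm_sym hm q) in b1 b2.
rewrite /btw l12; move: e1 e3 dpq => e1 e3 dpq.
lia.
Qed.

End Loxodromic.

Section ElementaryClosure.
Variables (H : groupType) (g : H).
Implicit Types y z : H.

Notation "g ^z m" := (gexpz g m) (at level 29, left associativity).

(* The commensurator of the cyclic group of [g]: for [g] loxodromic, the maximal
   elementary subgroup E(g). *)
Definition elem_closure y : Prop :=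
  exists m n : int, [/\ m <> 0%R, n <> 0%R & g ^z m * y = y * g ^z n].
Notation E := elem_closure.

Lemma elem_closureV y : E y -> E y^-1.
Proof.
move=> [m [n [m0 n0 e]]]; exists n, m; split=> //.
by apply: (mulgI y); apply: (mulIg y); rewrite !mulgA mulgVK mulgV mul1g e.
Qed.

Lemma elem_closureM y z : E y -> E z -> E (y * z).
Proof.
move=> [m [n [m0 n0 e]]] [m' [n' [m'0 n'0 e']]].
exists (m * m')%R, (n' * n)%R; split; [lia..|].
rewrite (gexpzM g m m') (gexpzM g n' n) mulgA (gexpz_conj e) -(gexpzM g n m').
by rewrite (mulrC n m') (gexpzM g m' n) -!mulgA (gexpz_conj e').
Qed.

Lemma elem_closure_gexpz m : E (g ^z m).
Proof. by exists 1%R, 1%R; split=> //; rewrite -!gexpzD addrC. Qed.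

Lemma elem_closureX y n : E y -> E (y ^+ n).
Proof.
move=> Ey; elim: n => [|n IHn]; first exact: (elem_closure_gexpz 0%R).
by rewrite expgS; apply: elem_closureM.
Qed.

End ElementaryClosure.

(** * The axis of a loxodromic element *)

Section LoxodromicAxis.
Variables (H : groupType) (d : H -> H -> nat) (dl : nat) (g : H) (C : nat).
Hypothesis hm : hyperbolic_metric d dl.
Hypothesis gC : btw d C 1 g (g ^+ 2).
Hypothesis gL : C + 2 * dl < d 1 g.
Implicit Types e x y z : H.

Notation "g ^z m" := (gexpz g m) (at level 29, left associativity).
Notation K := (C + 2 * dl).
Notation Lg := (d 1 g).

Lemma gline_chain i n :
  [/\ forall t, t.+1 < n -> btw d C (g ^z (i + t%:Z)%R)
        (g ^z (i + t.+1%:Z)%R) (g ^z (i + t.+2%:Z)%R)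
    & forall t, d (g ^z (i + t%:Z)%R) (g ^z (i + t.+1%:Z)%R) = Lg].
Proof.
split=> t; last first.
  have -> : (i + t.+1%:Z = i + t%:Z + 1)%R by lia.
  by rewrite [g ^z (_ + 1)%R]gexpzS (hm_mulr hm).
move=> _.
have -> : (i + t.+1%:Z = i + t%:Z + 1%:Z)%R by lia.
have -> : (i + t.+2%:Z = i + t%:Z + 2%:Z)%R by lia.
set m := (i + t%:Z)%R.
by rewrite !(gexpzD g m) (btw_mul1 hm).
Qed.

Lemma gline_btw i j k : (i <= j <= k)%R || (k <= j <= i)%R ->
  btw d K (g ^z i) (g ^z j) (g ^z k).
Proof.
wlog ik : i k / (i <= j <= k)%R => [hw|_].
  by case/orP=> [h|h]; [apply: hw|rewrite (btwC hm); apply: hw] => //; rewrite h.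
have [h1 h2] := gline_chain i `|k - i|%N.
have := chain_btw hm h1 (L := Lg) _ gL (i := `|j - i|%N).
have -> : (i + `|j - i|%N = j)%R by lia.
have -> : (i + `|k - i|%N = k)%R by lia.
rewrite addr0; apply; last by lia.
by move=> t _; rewrite h2.
Qed.

Lemma gline_growth (n : nat) : n <= d 1 (g ^+ n).
Proof.
have [h1 h2] := gline_chain 0%R n.
have := chain_growth hm h1 (L := Lg) _ gL (leqnn n).
by rewrite !add0r; apply=> t _; rewrite h2.
Qed.

Lemma gline_len i j : d (g ^z i) (g ^z j) = d 1 (g ^+ `|j - i|%N).
Proof.
wlog ij : i j / (i <= j)%R => [hw|].
  by have [/hw//|/ltW/hw] := lerP i j; rewrite (hm_sym hm) distnC.
have {1}-> : (j = i + `|j - i|%N)%R by lia.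
by rewrite gexpzD (hm_mulr hm).
Qed.

Lemma gline_far i j : `|j - i|%N <= d (g ^z i) (g ^z j).
Proof. by rewrite gline_len gline_growth. Qed.

Lemma gline_mono m n : m <= n -> d 1 (g ^+ m) <= d 1 (g ^+ n).
Proof.
elim: n => [|n IHn]; first by rewrite leqn0 => /eqP->.
rewrite leq_eqVlt => /orP[/eqP->//|/IHn] le; apply: leq_trans le _.
have [h1 h2] := gline_chain 0%R n.+1.
have := chain_step hm h1 (fun t _ => eq_leq (esym (h2 t))) gL (leqnn n.+1).
rewrite h2 !add0r => h.
have {}h : d 1 (g ^+ n) + Lg <= d 1 (g ^+ n.+1) + C + dl by exact: h.
lia.
Qed.

Lemma gline_lip i j : d (g ^z i) (g ^z j) <= `|j - i|%N * Lg.
Proof.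
rewrite gline_len; elim: `|_|%N => [|n IHn]; first by rewrite (hm_refl hm).
apply: leq_trans (hm_tri hm (g ^+ n) _ _) _.
by rewrite [g ^+ n.+1]expgSr (hm_mulr hm); lia.
Qed.

Lemma gexpz_eq1 m : g ^z m = 1 -> m = 0%R.
Proof.
by move=> e; have := gline_far 0%R m; rewrite e gexpz0 (hm_refl hm); lia.
Qed.

Lemma gexpz_inj m n : g ^z m = g ^z n -> m = n.
Proof. by move=> e; have := gline_far m n; rewrite e (hm_refl hm); lia. Qed.

Lemma gline_near K' i k z : K <= K' -> btw d K' (g ^z i) z (g ^z k) ->
  exists j, d z (g ^z j) <= Lg + K' + dl.
Proof.
move=> KK'; wlog ik : i k / (i <= k)%R => [hw|b].
  by have [/hw//|/ltW/hw h b] := lerP i k; apply: h; rewrite (btwC hm).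
have [h1 h2] := gline_chain i `|k - i|%N.
have [|||t _ zt] := near_chain hm (v := fun t : nat => g ^z (i + t%:Z)%R)
   (n := `|k - i|%N) (z := z) (K := K') (D := Lg).
- by move=> t _; rewrite h2.
- move=> t tlt; apply: (btw_mono KK'); apply: gline_btw; lia.
- have -> : (i + `|k - i|%N = k)%R by lia.
  by rewrite addr0.
by exists (i + t%:Z)%R.
Qed.

Notation E := (elem_closure g).

(** Far out in both directions, [e] times powers of [g] stays within [d 1 e] of powers of [g].
    Replacing the former by the latter puts [e] between two powers of [g], with a bound that does
    not depend on [e]. *)
Lemma elem_closure_near e : E e ->
  exists j, d e (g ^z j) <= Lg + (K + 2 * dl) + dl.
Proof.
move=> [m [n [m0 n0 eq]]].
pose k := d 1 e + K + 2 * dl + 1.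
have far (s : int) : s = 1%R \/ s = (-1)%R -> k <= d e (e * g ^z (n * (s * k))%R).
  move=> hs; rewrite (hm_mulr hm); have := gline_far 0%R (n * (s * k))%R.
  rewrite gexpz0; apply: leq_trans; rewrite subr0 !abszM; case: hs => ->; nia.
have sym (s : int) : d (e * g ^z (n * (s * k))%R) (g ^z (m * (s * k))%R) = d 1 e.
  by rewrite (gexpzM g n) (gexpzM g m) -(gexpz_conj eq) (hm_sym hm) (hm_mulr hm).
apply: (@gline_near (K + 2 * dl) (m * ((-1) * k%:Z))%R (m * (1 * k%:Z))%R e); first by lia.
apply: (btw_far2 hm (eq_leq (sym _)) (eq_leq (sym _))).
- have := far _ (or_intror erefl); rewrite (hm_sym hm) /k; lia.
- have := far _ (or_introl erefl); rewrite /k; lia.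
rewrite -{2}[e]mulg1 (btw_mul hm) -[1](gexpz0 g); apply: gline_btw.
have [n1|n1] := lerP n 0; apply/orP; [right|left]; apply/andP; split; nia.
Qed.

(** Every element is near the axis, so a finite ball contains representatives of all cosets of the
    subgroup generated by [g]. *)
Lemma virtually_cyclic_elem_closure : (forall y, E y) -> virtually_cyclic H.
Proof.
move=> all_E; exists (generated [set g]%classic); split; first by exists g.
have [s Hs] := hm_proper hm (Lg + (K + 2 * dl) + dl).
pose coset y := [set (y * c)%g | c in generated [set g]]%classic.
apply: (@sub_finite_set _ _ [set coset b^-1 | b in [set` s]]%classic); last first.
  exact/finite_image/finite_seq.
move=> _ [y _ <-]; have [j yj] := elem_closure_near (elem_closureV (all_E y)).
rewrite (hm_sym hm) (hm_len hm) in yj.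
exists ((g ^z j)^-1 * y^-1); first exact/Hs.
have gj A : subgroup A -> A g -> forall n, A (g ^z n).
  move=> sA Ag n; have [A1 AB] := sA.
  have AM := group_closedM sA; have AV := group_closedV sA.
  have An k : A (g ^+ k).
    elim: k => [|k /mem_set IHk]; first by rewrite -in_setE.
    by rewrite expgS -in_setE; apply: AM => //; apply: mem_set.
  by case: n => n /=; rewrite -in_setE ?AV //; apply/mem_set.
have sub n y' : (coset (y' * g ^z n) `<=` coset y')%classic.
  move=> _ [c cG <-]; exists (g ^z n * c); last by rewrite mulgA.
  move=> A [sA Ag]; rewrite -in_setE; apply: (group_closedM sA); apply/mem_set.
    by apply: gj => //; apply: Ag.
  by apply: cG.
rewrite invgM !invgK; apply/seteqP; split; first exact: sub.
by rewrite -{1}[y](mulgK (g ^z j)) -gexpzN; apply: sub.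
Qed.

Section TorsionFree.
Hypothesis tf : torsion_free H.

(** All powers of [e] are near the axis; by pigeonhole two of them have the same offset from it, so
    their quotient is a power of [g]. *)
Lemma elem_closure_power e : E e -> e <> 1 ->
  exists a b, [/\ 0 < a, b <> 0%R & e ^+ a = g ^z b].
Proof.
move=> Ee e1.
have /choice[j Hj] : forall i : nat, exists j,
    d (e ^+ i) (g ^z j) <= Lg + (K + 2 * dl) + dl.
  by move=> i; apply/elem_closure_near/elem_closureX.
have [N HN] := hm_pigeon hm (Lg + (K + 2 * dl) + dl).
have [|i [i' [/andP[ii' _] eqf]]] := HN (fun i => (g ^z (j i))^-1 * e ^+ i).
  by move=> i _; rewrite -(hm_len hm) (hm_sym hm).
have eqe : e ^+ (i' - i) = g ^z (j i' - j i)%R.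
  rewrite expgnFr ?(ltnW ii') // gexpzB.
  apply: (mulgI (g ^z (j i'))^-1); rewrite mulgA -eqf mulgK.
  by rewrite mulKg.
exists (i' - i), (j i' - j i)%R; split=> //; first by rewrite subn_gt0.
move=> j0; apply: e1; apply: (tf (n := i' - i)); rewrite ?subn_gt0 //.
by rewrite eqe j0.
Qed.

(** Both [e] and its conjugate have powers that are powers of [g]; at a common exponent, [x]
    conjugates one to the other. *)
Lemma elem_closure_malnormal e x : E e -> e <> 1 -> E (x^-1 * e * x) -> E x.
Proof.
move=> Ee e1 Ee'.
have e'1 : x^-1 * e * x <> 1.
  by move=> h; apply: e1; apply: (mulgI x^-1); apply: (mulIg x); rewrite h mulg1 mulVg.
have [a [b [a0 b0 eqe]]] := elem_closure_power Ee e1.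
have [a' [b' [a'0 b'0 eqe']]] := elem_closure_power Ee' e'1.
exists (b * a')%R, (b' * a)%R; split; [nia..|].
rewrite !gexpzMn -eqe -eqe' -!expgnA (mulnC a' a).
have ex : e * x = x * (x^-1 * e * x) by rewrite -mulgA mulVKg.
exact: (gexpz_conj ex (a * a')%N).
Qed.

(** The square of [x * u] lies in E(g) and is centralized by [x * u], which malnormality then puts
    in E(g). *)
Lemma elem_closure_sqr x u : E u -> E (x * u * x) -> E x.
Proof.
move=> Eu Exux; have E2 : E ((x * u) ^+ 2).
  by rewrite expg2 mulgA; apply: elem_closureM.
suff Exu : E (x * u).
  by rewrite -[x](mulgK u); apply: elem_closureM => //; apply: elem_closureV.
have [xu1|xu1] := pselect (x * u = 1); first by rewrite xu1; exact: (elem_closure_gexpz g 0%R).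
apply: (elem_closure_malnormal E2).
  by move=> /tf h; apply: xu1; apply: h.
by rewrite expg2 mulKg -expg2.
Qed.

End TorsionFree.

(* In a tree, [ab + cd - ac - bd] is at most twice the length of the common part
   of the segments [ab] and [cd]: axes of distinct cosets of E(g) have a bounded
   common part, since a long one would make [c^-1 * c'] conjugate a power of [g]
   to a power of [g] by the pigeonhole principle. *)
Lemma overlap_bound : exists B, forall c c', ~ E (c^-1 * c') -> forall i j k l,
  d (c * g ^z i) (c * g ^z j) + d (c' * g ^z k) (c' * g ^z l) <=
  d (c * g ^z i) (c' * g ^z k) + d (c * g ^z j) (c' * g ^z l) + B.
Proof.
have [N HN] := hm_pigeon hm (Lg + (K + 2 * dl) + dl).
(* [U] bounds the length of [N.+1] steps of the axis, the room that the pigeonhole principle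
   takes. *)
pose U := (N.+1 * Lg)%N; exists (4 * K + 5 * dl + 2 * U + 2 * Lg)%N => c c' nE i j k l.
rewrite -!(hm_mul hm c^-1 (c * _)) !mulKg !(mulgA c^-1 c') (hm_mul hm c').
rewrite -(hm_mul hm (c^-1 * c') (g ^z k)).
move: (c^-1 * c') nE => y nE {c c'}.
wlog ij : i j k l / (i <= j)%R => [hw|].
  have [/hw//|/ltW/hw h] := lerP i j.
  rewrite (hm_sym hm (g ^z i)) (hm_sym hm (y * g ^z k)).
  by rewrite (addnC (d (g ^z i) _)).
rewrite leqNgt; apply/negP => lt; apply: nE.
set a := g ^z i in lt; set b := g ^z j in lt.
set p := y * g ^z k in lt; set q := y * g ^z l in lt.
pose n := `|j - i|%N; pose v (t : nat) := g ^z (i + t%:Z)%R.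
have v0 : v 0 = a by rewrite /v addr0.
have vn : v n = b by rewrite /v; congr (g ^z _); lia.
have h1 := hm_hyp hm a p b q; have h2 := hm_hyp hm a b q p.
have t1 := hm_tri hm b p q; have t2 := hm_tri hm a p q.
have t3 := hm_tri hm p a b; have t4 := hm_tri hm q a b.
rewrite ?(hm_sym hm q p) ?(hm_sym hm p b) ?(hm_sym hm q b) ?(hm_sym hm p a) in h1 h2 t1 t2 t3 t4.
(* Twice the Gromov product of [p] and [b] at [a], that is, twice the position where the overlap
   begins on the segment from [a] to [b], plus a margin. *)
pose r := d a p + d a b - d b p + 2 * K + dl.
have [||s sn /andP[s1 s2]] := @nat_ivt (fun t => 2 * d a (v t))%N r n.
- by rewrite v0 (hm_refl hm).
- by rewrite vn /r; lia.
(* The next [N.+1] powers of [g] are inside the overlap, hence near the other axis. *)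
have good t : t <= N -> (s.+1 + t <= n) /\
    exists m, d (v (s.+1 + t)) (y * g ^z m) <= Lg + (K + 2 * dl) + dl.
  move=> tN.
  have upper w : s <= w -> w <= s + N.+1 -> (2 * d a (v w) <= r + 2 * U)%N.
    move=> sw wN; have := hm_tri hm (v s) a (v w).
    have : d (v s) (v w) <= U.
      by apply: leq_trans (gline_lip _ _) _; rewrite leq_mul2r; apply/orP; right; lia.
    lia.
  have tn : s.+1 + t <= n.
    by rewrite leqNgt; apply/negP => ltn; have := upper n; rewrite vn /r; lia.
  split=> //; set z := v (s.+1 + t).
  have lo : (r < 2 * d a z)%N.
    apply: leq_trans s2 _; rewrite leq_mul2l /= /a /z /v !gline_len.
    by apply: gline_mono; lia.
  have up : (2 * d a z <= r + 2 * U)%N by apply: upper; lia.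
  have zK : btw d K a z b by apply: gline_btw; lia.
  have zpq : btw d (K + 2 * dl) p z q.
    clearbody z; move: zK; rewrite /btw => zK.
    have h3 := hm_hyp hm a z b p; have h4 := hm_hyp hm p z b q.
    have t5 := hm_tri hm z b p; have t6 := hm_tri hm z a q.
    have t7 := hm_tri hm z a b.
    rewrite ?(hm_sym hm p z) ?(hm_sym hm p b) ?(hm_sym hm b z) in h3 h4 t5 t6 t7 *.
    lia.
  have [||m zm] := @gline_near (K + 2 * dl) k l (y^-1 * z).
  - by lia.
  - by rewrite -(btw_mul hm _ y) mulVKg.
  by exists m; rewrite -{1}[z](mulVKg y) (hm_mul hm).
have /choice[m Hm] : forall t, exists m, t <= N ->
    d (v (s.+1 + t)) (y * g ^z m) <= Lg + (K + 2 * dl) + dl.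
  by move=> t; have [/good[_ [m]]|] := leqP t N; [exists m|exists 0%R].
have [|t [t' [/andP[tt' t'N] e]]] := HN (fun t => (v (s.+1 + t))^-1 * (y * g ^z (m t))).
  by move=> t tN; rewrite -(hm_len hm); apply: Hm.
have ey : g ^z (t'%:Z - t%:Z)%R * y = y * g ^z (m t' - m t)%R.
  rewrite (gexpzB g (m t')) mulgA; apply: (mulIg (g ^z (m t))); rewrite mulgVK.
  apply: (mulgI (v (s.+1 + t'))^-1); rewrite -e.
  rewrite !mulgA; congr (_ * _ * _).
  by rewrite /v -!gexpzN -gexpzD; congr (g ^z _); lia.
exists (t'%:Z - t%:Z)%R, (m t' - m t)%R; split=> //; first by lia.
move=> m0; rewrite m0 mulg1 in ey.
have : (t'%:Z - t%:Z)%R = 0%R by apply: gexpz_eq1; apply: (mulIg y); rewrite ey mul1g.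
by lia.
Qed.
End LoxodromicAxis.

(** * Broken lines *)

(* [r] and [r'] are the positions, along a common geodesic, of the vertices of two
   broken lines; [P t s] says that the [t]-th piece of the first and the [s]-th
   piece of the second lie in the same coset. *)
Section Interleaving.
Variables (r r' : nat -> nat) (P : nat -> nat -> Prop) (t0 t1 n' G T : nat).
Hypothesis rG : forall t, t0 <= t -> t < t1 -> r t + G <= r t.+1.
Hypothesis r'G : forall s, s < n' -> r' s + G <= r' s.+1.
Hypothesis ltTG : 3 * T < G.
Hypothesis r_in : forall t, t0 <= t -> t <= t1 -> r' 0 <= r t < r' n'.
Hypothesis overlap : forall t s, t0 <= t -> t < t1 -> s < n' -> ~ P t s ->
  r t.+1 + r' s.+1 <=
  r t + r' s + `|Posz (r t) - Posz (r' s)|%N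
    + `|Posz (r t.+1) - Posz (r' s.+1)|%N + T.
Hypothesis P_uniq_l : forall t s, t0 <= t -> t.+1 < t1 -> s < n' -> P t s -> ~ P t.+1 s.
Hypothesis P_uniq_r : forall t s, t0 <= t -> t < t1 -> s.+1 < n' -> P t s -> ~ P t s.+1.

(** A vertex far from all vertices of the second line would be well inside one of its pieces; both
    pieces of the first line at this vertex would then lie in the coset of that piece. *)
Lemma interleave_cut t : t0 < t -> t < t1 ->
  exists2 s, s <= n' & (r t <= r' s + T) && (r' s <= r t + T).
Proof.
move=> tgt tlt; have /andP[r1 r2] := r_in (ltnW tgt) (ltnW tlt).
have [s slt /andP[s1 s2]] := nat_ivt r1 r2.
case: t tgt tlt {r1 r2} s1 s2 => // t tgt tlt s1 s2.
have [h1|h1] := leqP (r t.+1) (r' s + T); first by exists s; [exact: ltnW|lia].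
have [h2|h2] := leqP (r' s.+1) (r t.+1 + T); first by exists s.+1 => //; lia.
have g1 := rG tgt (ltnW tlt); have g2 := rG (leqW tgt) tlt; have g3 := r'G slt.
exfalso; apply: (@P_uniq_l t s) => //.
  by apply: contrapT => /overlap; lia.
by apply: contrapT => /overlap; lia.
Qed.

Lemma interleave_mono s s' : s <= s' -> s' <= n' -> r' s <= r' s'.
Proof.
elim: s' => [|s' IHs']; first by rewrite leqn0 => /eqP->.
rewrite leq_eqVlt => /orP[/eqP->//|ss'] s'n.
by have := IHs' ss' (ltnW s'n); have := r'G s'n; lia.
Qed.

(** If a vertex of the second line were skipped, the piece [t] would overlap two consecutive pieces
    and lie in the cosets of both. *)
Lemma interleave_succ t s s' : t0 <= t -> t < t1 -> s <= n' -> s' <= n' ->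
  (r t <= r' s + T) && (r' s <= r t + T) ->
  (r t.+1 <= r' s' + T) && (r' s' <= r t.+1 + T) -> s' = s.+1 /\ P t s.
Proof.
move=> tgt tlt sn s'n h1 h2; have g1 := rG tgt tlt.
have ss' : s < s'.
  by rewrite ltnNge; apply/negP => /interleave_mono/(_ sn); lia.
have sn' : s < n' by lia.
have g2 := r'G sn'.
have m1 := interleave_mono ss' s'n.
have Pts : P t s by apply: contrapT => /overlap; lia.
split=> //; apply/eqP; rewrite eqn_leq ss' andbT leqNgt; apply/negP => lt.
have sn2 : s.+1 < n' by lia.
have g3 := r'G sn2; have m2 := interleave_mono lt s'n.
by apply: (P_uniq_r tgt tlt sn2 Pts); apply: contrapT => /overlap; lia.
Qed.

End Interleaving.

(* [B] bounds the overlap of the axes of distinct cosets, and [L] is a lower bound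
   on the lengths of the pieces of the broken lines. *)
Record axis_pair (H : groupType) (d : H -> H -> nat) (dl : nat) (g x : H)
    (C B L : nat) : Prop := AxisPair {
  ap_hm : hyperbolic_metric d dl;
  ap_tf : torsion_free H;
  ap_gC : btw d C 1 g (g ^+ 2);
  ap_gL : C + 2 * dl < d 1 g;
  ap_xE : ~ elem_closure g x;
  ap_overlap c c' : ~ elem_closure g (c^-1 * c') -> forall i j k l,
    d (c * gexpz g i) (c * gexpz g j) + d (c' * gexpz g k) (c' * gexpz g l) <=
    d (c * gexpz g i) (c' * gexpz g k) + d (c * gexpz g j) (c' * gexpz g l) + B;
  ap_L : 10 * (B + 4 * d 1 x + 8 * dl) < L }.

Section BrokenLines.
Variables (H : groupType) (d : H -> H -> nat) (dl : nat) (g x : H) (C B L : nat).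
Hypothesis ap : axis_pair d dl g x C B L.
Let hm := ap_hm ap.
Let tf := ap_tf ap.
Let gC := ap_gC ap.
Let gL := ap_gL ap.
Let xE := ap_xE ap.
Let overlap := ap_overlap ap.
Let LB := ap_L ap.

Notation "g ^z m" := (gexpz g m) (at level 29, left associativity).
Notation E := (elem_closure g).
Notation X := (d 1 x).

Definition sgx (b : bool) : H := if b then x^-1 else x.

Lemma sgxE b : ~ E (sgx b).
Proof. by case: b => //= /elem_closureV; rewrite invgK. Qed.

Lemma len_sgx b : d 1 (sgx b) = X.
Proof. by case: b; rewrite //= (hm_inv hm). Qed.

(** For equal signs this is malnormality, for opposite signs [elem_closure_sqr]. With [u] the offset
    between vertices of two broken lines, it makes the vertices equal. *)
Lemma elem_closure_sgx a b u : E u -> E ((sgx a)^-1 * u * sgx b) ->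
  u = 1 /\ a = b.
Proof.
move=> Eu; have [<-|ab] := eqVneq a b => [h|].
  split=> //; apply: contrapT => u1; apply: (@sgxE a).
  exact: (elem_closure_malnormal hm gC gL tf Eu).
case: a b ab => -[] //= _; rewrite ?invgK => /(elem_closure_sqr hm gC gL tf Eu) //.
by move/elem_closureV; rewrite invgK.
Qed.

(* A broken line alternates the letter [x] or its inverse with long powers of
   [g]; its [t]-th piece lies in the coset of [v t * sgx (eps t)]. *)
Definition broken_line n (v : nat -> H) (eps : nat -> bool) (e : nat -> int) :=
  forall t, t < n -> v t.+1 = v t * sgx (eps t) * g ^z (e t) /\ L + X <= d 1 (g ^z (e t)).

Section OneLine.
Variables (n : nat) (v : nat -> H) (eps : nat -> bool) (e : nat -> int).
Hypothesis vl : broken_line n v eps e.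

Lemma broken_line_foot t : d (v t) (v t * sgx (eps t)) = X.
Proof. by rewrite (hm_mulr hm) len_sgx. Qed.

Lemma broken_line_len t : t < n -> L <= d (v t) (v t.+1).
Proof.
move=> tn; have [-> eL] := vl tn.
have := hm_tri hm (v t) (v t * sgx (eps t)) (v t * sgx (eps t) * g ^z e t).
by rewrite (hm_sym hm _ (v t)) broken_line_foot (hm_mulr hm); lia.
Qed.

Lemma broken_line_turn t : t.+1 < n ->
  ~ E ((v t * sgx (eps t))^-1 * (v t.+1 * sgx (eps t.+1))).
Proof.
move=> /ltnW/vl[-> _]; rewrite -!mulgA invgM -mulgA mulKg mulKg => Eg.
apply: (@sgxE (eps t.+1)); rewrite -(mulKg (g ^z e t) (sgx _)) -gexpzN.
by apply: elem_closureM => //; apply: elem_closure_gexpz.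
Qed.

Lemma broken_line_btw t : t.+1 < n ->
  btw d (B + 4 * X) (v t) (v t.+1) (v t.+2).
Proof.
move=> tn; have [e1 _] := vl (ltnW tn); have [e2 _] := vl tn.
(* The second piece is run backwards, so that the overlap bound controls the turn at [v t.+1]. *)
have := overlap (broken_line_turn tn) 0%R (e t) (e t.+1) 0%R.
rewrite -e1 -e2 !gexpz0 !mulg1.
have := broken_line_foot t; have := broken_line_foot t.+1.
set a := v t * _; set b := v t.+1 * _ => b1 a1; rewrite /btw.
have := hm_tri hm a (v t) (v t.+1); have := hm_tri hm b (v t.+1) (v t.+2).
have := hm_tri hm (v t) a (v t.+2).
rewrite (hm_sym hm a (v t)) (hm_sym hm (v t.+2) b); lia.
Qed.

Lemma broken_line_step t : t < n -> btw d (B + 4 * X + dl) (v 0) (v t) (v t.+1).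
Proof. by apply: (chain_fwd hm broken_line_btw broken_line_len); lia. Qed.

Lemma broken_line_growth t : t <= n -> t <= d (v 0) (v t).
Proof. by apply: (chain_growth hm broken_line_btw broken_line_len); lia. Qed.

Lemma broken_line_on t : t <= n -> btw d (B + 4 * X + 2 * dl) (v 0) (v t) (v n).
Proof. by apply: (chain_btw hm broken_line_btw broken_line_len); lia. Qed.

End OneLine.

Lemma broken_line_shift n v eps e s : broken_line n v eps e ->
  broken_line (n - s) (fun t => v (s + t)) (fun t => eps (s + t)) (fun t => e (s + t)).
Proof. by move=> vl t tn; rewrite addnS; apply: vl; lia. Qed.

Lemma broken_line_end n v eps e t : broken_line n v eps e -> t <= n ->
  n - t <= d (v t) (v n).
Proof.
move=> vl tn; have := broken_line_growth (broken_line_shift (s := t) vl) (leqnn _).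
by rewrite addn0 subnKC.
Qed.

(** Along a geodesic between the ends of the second line, the vertices of both lines interleave and
    pieces match one to one; [elem_closure_sgx] turns consecutive matches into equalities of
    vertices. *)
Lemma broken_line_match n v eps e n' v' eps' e' A :
  broken_line n v eps e -> broken_line n' v' eps' e' ->
  d (v 0) (v' 0) <= A -> d (v n) (v' n') <= A ->
  2 * (A + B + 4 * X + 4 * dl) + 10 < n ->
  exists t s, [/\ 0 < t, t.+1 < n, 0 < s, s.+1 < n' & v t.+1 = v' s.+1 /\ e t = e' s].
Proof.
move=> vl vl' v0A vnA nA.
pose o := v' 0; pose z := v' n'.
(* Vertices at least [t0] steps from both ends are so far from them that moving the ends by [A]
   costs only [2 * dl]. *)
pose t0 := A + B + 4 * X + 4 * dl + 1; pose t1 := n - t0.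
pose K2 := B + 4 * X + 4 * dl.
have on' s : s <= n' -> btw d K2 o (v' s) z.
  by move=> /(broken_line_on vl'); apply: btw_mono; rewrite /K2; lia.
have on t : t0 <= t -> t <= t1 -> btw d K2 o (v t) z.
  move=> tgt tlt; have tn : t <= n by rewrite /t1 in tlt; lia.
  have -> : K2 = B + 4 * X + 2 * dl + 2 * dl by rewrite /K2; lia.
  apply: (btw_far2 hm v0A vnA); last exact: (broken_line_on vl tn).
    by have := broken_line_growth vl tn; rewrite /t0 in tgt; lia.
  by have := broken_line_end vl tn; rewrite /t1 /t0 in tlt; lia.
pose P t s := E ((v t * sgx (eps t))^-1 * (v' s * sgx (eps' s))).
have [T HT] : exists T, T = 3 * B + 12 * X + 10 * dl by eexists.
pose r t := d o (v t); pose r' s := d o (v' s).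
have rG t : t0 <= t -> t < t1 -> r t + (L - (B + 4 * X + 2 * dl)) <= r t.+1.
  move=> tgt tlt; have tn : t < n by rewrite /t1 in tlt; lia.
  have := btw_far hm v0A _ (broken_line_step vl tn).
  have := broken_line_growth vl (ltnW tn); have := broken_line_len vl tn.
  by rewrite /btw /r -/o; rewrite /t0 in tgt; lia.
have r'G s : s < n' -> r' s + (L - (B + 4 * X + 2 * dl)) <= r' s.+1.
  move=> sn; have := broken_line_step vl' sn; have := broken_line_len vl' sn.
  by rewrite /btw /r' -/o; lia.
have ltTG : 3 * T < L - (B + 4 * X + 2 * dl) by lia.
have r_in t : t0 <= t -> t <= t1 -> r' 0 <= r t < r' n'.
  move=> tgt tlt; rewrite /r' (hm_refl hm) /=; have := on _ tgt tlt.
  have tn : t <= n by rewrite /t1 in tlt; lia.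
  have := broken_line_end vl tn; have := hm_tri hm z (v t) (v n).
  have : d (v n) z <= A by [].
  by rewrite /btw /r -/z (hm_sym hm z); rewrite /t1 /t0 /K2 in tlt *; lia.
have olap t s : t0 <= t -> t < t1 -> s < n' -> ~ P t s ->
  r t.+1 + r' s.+1 <=
  r t + r' s + `|Posz (r t) - Posz (r' s)|%N
    + `|Posz (r t.+1) - Posz (r' s.+1)|%N + T.
  move=> tgt tlt sn nP; have tn : t < n by rewrite /t1 in tlt; lia.
  have := overlap nP 0%R (e t) 0%R (e' s); rewrite !gexpz0 !mulg1.
  have [<- _] := vl _ tn; have [<- _] := vl' _ sn.
  have := broken_line_foot v eps t; have := broken_line_foot v' eps' s.
  set a := v t * _; set b := v' s * _ => b1 a1.
  have t2 := hm_tri hm a (v t) (v t.+1); have t3 := hm_tri hm b (v' s) (v' s.+1).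
  have t4 := hm_tri hm (v t) a b; have t5 := hm_tri hm (v' s) (v t) b.
  have t6 := hm_tri hm (v t) o (v t.+1); have t7 := hm_tri hm (v' s) o (v' s.+1).
  have l1 := btw_line hm (on _ tgt (ltnW tlt)) (on' _ (ltnW sn)).
  have l2 := btw_line hm (on' _ (ltnW sn)) (on _ tgt (ltnW tlt)).
  have l3 := btw_line hm (on _ (leqW tgt) tlt) (on' _ sn).
  have l4 := btw_line hm (on' _ sn) (on _ (leqW tgt) tlt).
  rewrite (hm_sym hm a (v t)) in t4.
  rewrite (hm_sym hm (v' s) (v t)) in l2; rewrite (hm_sym hm (v' s.+1) (v t.+1)) in l4.
  by rewrite /r /r'; rewrite /K2 in l1 l2 l3 l4; lia.
have uniq_l t s : t0 <= t -> t.+1 < t1 -> s < n' -> P t s -> ~ P t.+1 s.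
  move=> _ tlt _ h1 /elem_closureV h2; have tn : t.+1 < n by rewrite /t1 in tlt; lia.
  apply: (broken_line_turn vl tn); have := elem_closureM h1 h2.
  have -> // (a b c : H) : a^-1 * b * (c^-1 * b)^-1 = a^-1 * c.
  by rewrite invgM invgK mulgA mulgK.
have uniq_r t s : t0 <= t -> t < t1 -> s.+1 < n' -> P t s -> ~ P t s.+1.
  move=> _ tlt sn /elem_closureV h1 h2.
  apply: (broken_line_turn vl' sn); have := elem_closureM h1 h2.
  have -> // (a b c : H) : (a^-1 * b)^-1 * (a^-1 * c) = b^-1 * c.
  by rewrite invgM invgK mulgA mulgK.
have cut := interleave_cut rG r'G ltTG r_in olap uniq_l.
have succ := interleave_succ rG r'G ltTG olap uniq_r.
have t01 : t0 + 5 < t1 by rewrite /t1 /t0; lia.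
have foot t s : P t s -> t < n -> s < n' -> E ((v t.+1)^-1 * v' s.+1).
  move=> Pts /vl[-> _] /vl'[-> _].
  have -> (a b u w : H) : (a * u)^-1 * (b * w) = u^-1 * (a^-1 * b) * w.
    by rewrite invgM !mulgA.
  rewrite -gexpzN; do 2?apply: elem_closureM => //; exact: elem_closure_gexpz.
have agree t s : P t s -> P t.+1 s.+1 -> t < n -> s < n' ->
    v t.+1 = v' s.+1 /\ eps t.+1 = eps' s.+1.
  move=> /foot h Pts tn sn; have [] := elem_closure_sgx (h tn sn) (a := eps t.+1) (b := eps' s.+1).
    have -> (a b u w : H) : u^-1 * (a^-1 * b) * w = (a * u)^-1 * (b * w).
      by rewrite invgM !mulgA.
    exact: Pts.
  by move=> /(congr1 (mul (v t.+1))); rewrite mulVKg mulg1.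
(* Four cuts give three consecutive matching pieces, hence two consecutive common vertices, hence a
   common exponent between them. *)
have [s1 s1n c1] := cut t0.+1 (leqnn _) ltac:(lia).
have [s2 s2n c2] := cut t0.+2 ltac:(lia) ltac:(lia).
have [s3 s3n c3] := cut t0.+3 ltac:(lia) ltac:(lia).
have [s4 s4n c4] := cut t0.+4 ltac:(lia) ltac:(lia).
have [e2 P1] := succ _ _ _ (leqnSn _) ltac:(lia) s1n s2n c1 c2.
have [e3 P2] := succ t0.+2 _ _ ltac:(lia) ltac:(lia) s2n s3n c2 c3.
have [e4 P3] := succ t0.+3 _ _ ltac:(lia) ltac:(lia) s3n s4n c3 c4.
subst s2 s3 s4.
have t1n : t1 < n by rewrite /t1 /t0; lia.
have [v2 eps2] := agree _ _ P1 P2 ltac:(lia) ltac:(lia).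
have [v3 _] := agree _ _ P2 P3 ltac:(lia) ltac:(lia).
exists t0.+2, s1.+1; split; [lia..|split=> //].
have [] := vl t0.+2; first by lia.
have [] := vl' s1.+1; first by lia.
rewrite -v3 -v2 -eps2 => -> _ /mulgI e23 _.
exact: esym (gexpz_inj hm gC gL e23).
Qed.

End BrokenLines.

(** * The free subgroup *)

(** A sum of two powers of 4 has no carry in base 4, so its digits determine the two exponents. *)
Lemma pow4_sidon p q r s : p != q -> 4 ^ p + 4 ^ s = 4 ^ r + 4 ^ q -> p = r.
Proof.
have mono i j : i < j -> 4 * 4 ^ i <= 4 ^ j by rewrite -expnS; exact: leq_pexp2l.
have pos i : 0 < 4 ^ i by rewrite expn_gt0.
move=> /negP pq; have [pr|rp|//] := ltngtP p r.
- have [/mono|/mono|e] := ltngtP s q.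
  + by have := mono _ _ pr; have := pos s; lia.
  + have := mono _ _ pr; have := pos p; have := pos q.
    have [/mono|/mono|<-] := ltngtP s r; [lia|lia|] => _ _ _ _ e.
    by case: pq; rewrite -(eqn_exp2l _ _ (isT : 1 < 4)); apply/eqP; lia.
  + by have := mono _ _ pr; have := pos p; rewrite e; lia.
- have [/mono|/mono|e] := ltngtP s q.
  + have := mono _ _ rp; have := pos r; have := pos s.
    have [/mono|/mono|e] := ltngtP p q; [lia|lia|].
    by move: pq; rewrite e eqxx.
  + by have := mono _ _ rp; have := pos q; lia.
  + by have := mono _ _ rp; have := pos r; rewrite e; lia.
Qed.

Section FreeSubgroup.
Variables (H : groupType) (d : H -> H -> nat) (dl : nat) (g x : H) (C B L k : nat).
Hypothesis ap : axis_pair d dl g x C B L.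
Let hm := ap_hm ap.
Let tf := ap_tf ap.
Let gC := ap_gC ap.
Let gL := ap_gL ap.
Let LB := ap_L ap.

Notation "g ^z m" := (gexpz g m) (at level 29, left associativity).
Notation X := (d 1 x).

Variable a0 : 'I_k * bool.
Implicit Types (a b : 'I_k * bool) (w : seq ('I_k * bool)).

Definition letter_code a : nat := 2 * a.1 + a.2.

Lemma letter_code_inj : injective letter_code.
Proof.
move=> [i b1] [j b2]; rewrite /letter_code /= => e.
have ij : i = j by apply: val_inj; case: b1 b2 e => -[] /=; lia.
by rewrite ij; congr pair; case: b1 b2 e => -[] //=; rewrite ij; lia.
Qed.

(* These exponents form a Sidon set: a nonzero difference of two of them
   determines both. *)
Definition theta a : nat := (L + X).+1 * 4 ^ letter_code a.

Definition letter a : H :=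
  g ^z (theta a) * sgx x a.2 * g ^z (- (theta (inv_letter a))%:Z)%R.

Lemma theta_sidon a b a' b' : a != b ->
  ((theta a)%:Z - (theta b)%:Z = (theta a')%:Z - (theta b')%:Z)%R -> a = a'.
Proof.
move=> ab e; apply: letter_code_inj.
apply: (@pow4_sidon _ (letter_code b) _ (letter_code b')).
  by rewrite (inj_eq letter_code_inj).
have {}e : theta a + theta b' = theta a' + theta b by lia.
by apply/eqP; rewrite -(eqn_pmul2l (ltn0Sn (L + X))) !mulnDr; apply/eqP.
Qed.

Lemma theta_ge a : L + X <= theta a.
Proof. have : (0 < 4 ^ letter_code a)%N by rewrite expn_gt0.
by rewrite /theta; nia. Qed.

Lemma theta_far a b : a != b -> L + X <= `|Posz (theta a) - Posz (theta b)|%N.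
Proof.
move=> ab; have ne : (4 ^ letter_code a != 4 ^ letter_code b)%N.
  by rewrite eqn_exp2l // (inj_eq letter_code_inj).
rewrite /theta; move: ne; set u := (4 ^ _)%N; set v := (4 ^ _)%N; nia.
Qed.

Lemma letterV a : letter (inv_letter a) = (letter a)^-1.
Proof.
rewrite /letter inv_letterK !invgM -!gexpzN opprK mulgA.
by case: a => i []; rewrite /= ?invgK.
Qed.

Definition word_eval w : H := foldr (fun a y => letter a * y) 1 w.

Lemma word_eval_cat u w : word_eval (u ++ w) = word_eval u * word_eval w.
Proof. by elim: u => [|a u IHu] /=; rewrite ?mul1g // IHu mulgA. Qed.

Lemma word_eval_push u w :
  word_eval (foldr (@push_letter _) w u) = word_eval u * word_eval w.
Proof.
elim: u => [|a u IHu] /=; first by rewrite mul1g.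
rewrite -mulgA -{}IHu; case: foldr => [|b v] //=; case: eqP => [->|//].
by rewrite letterV mulVKg.
Qed.

(** The letters of index [t] and [t - 1] contribute [tin w t] and the opposite of [tout w t] to the
    power of [g] between them; 0 means that [w] has no such letter. *)
Definition tin w t : nat := if t < size w then theta (nth a0 w t) else 0.
Definition tout w t : nat :=
  if t is t'.+1 then theta (inv_letter (nth a0 w t')) else 0.

(* The vertices other than the first are the end points of the powers of [g] that
   arise when the powers of consecutive letters of [w] are merged; the first is
   [h * x^-1] instead of [h] so that the first piece, like the others, is a letter
   [x] followed by a power of [g]. *)
Definition word_line h w t : H :=
  if t is t'.+1 then h * word_eval (take t' w) * g ^z (tin w t') else h * x^-1.
Definition word_sign w t := if t is t'.+1 then (nth a0 w t').2 else false.
Definition word_exp w t : int := ((tin w t)%:Z - (tout w t)%:Z)%R.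

Lemma word_line_end h w : word_line h w (size w).+1 = h * word_eval w.
Proof. by rewrite /= take_size /tin ltnn mulg1. Qed.

(** At the ends of [w] the exponent is a single value of [theta] up to sign; elsewhere it is a
    difference of two, taken at distinct letters because [w] is reduced. *)
Lemma word_line_broken h w : reduced w -> w != [::] ->
  broken_line d g x L (size w).+1 (word_line h w) (word_sign w) (word_exp w).
Proof.
move=> rw w0 t; rewrite ltnS => tn; split.
  case: t tn => [|t] tn.
    have -> : word_exp w 0 = Posz (tin w 0) by rewrite /word_exp /=; lia.
    by rewrite /= take0 mulg1 mulgVK.
  rewrite /= (take_nth a0 tn) -cats1 word_eval_cat /= mulg1 /letter.
  rewrite {2}/tin tn /word_exp /= addrC gexpzD.
  by rewrite !mulgA.
have far m : L + X <= `|m|%N -> L + X <= d 1 (g ^z m).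
  by move=> /leq_trans-> //; rewrite -(gexpz0 g) -{1}[m]subr0; apply: (gline_far hm gC gL).
apply: far; rewrite /word_exp /tin; case: t tn => [|t] tn /=.
  by rewrite lt0n size_eq0 w0; have := theta_ge (nth a0 w 0); lia.
case: ltnP => tw; last by have := theta_ge (inv_letter (nth a0 w t)); lia.
apply: theta_far; move: rw; rewrite /reduced => /(sortedP a0)/(_ t tw).
by [].
Qed.

(** The line starts at [x^-1], at distance [X] from 1; exceeding [X] is what separates the value of
    [w] from 1. *)
Lemma word_eval_far w : reduced w -> w != [::] -> X < d x^-1 (word_eval w).
Proof.
move=> rw w0; have vl := word_line_broken 1 rw w0.
have := broken_line_step ap vl (ltnSn _).
have := broken_line_len ap vl (ltnSn _).
by rewrite /btw word_line_end /= !mul1g; lia.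
Qed.

Lemma word_eval_neq1 w : reduced w -> w != [::] -> word_eval w <> 1.
Proof.
move=> rw w0 e; have := word_eval_far rw w0.
by rewrite e (hm_sym hm x^-1) (hm_inv hm) ltnn.
Qed.

Definition free_image : set H := [set y | exists2 w, reduced w & word_eval w = y]%classic.

Lemma free_image_eval w : free_image (word_eval w).
Proof.
exists (reduce w); first exact: reduced_foldr.
by rewrite /reduce word_eval_push mulg1.
Qed.

Lemma free_imageM y z : free_image y -> free_image z -> free_image (y * z).
Proof.
move=> [u _ <-] [w _ <-]; rewrite -word_eval_cat; exact: free_image_eval.
Qed.

Lemma free_imageV y : free_image y -> free_image y^-1.
Proof.
move=> [w rw <-]; exists (inv_word w); first exact: reduced_inv_word.
apply/esym/mulg1_eq; rewrite -word_eval_cat.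
have -> : word_eval (w ++ inv_word w) = word_eval (reduce (w ++ inv_word w)).
  by rewrite /reduce word_eval_push mulg1.
have : free_mul (FreeGroup rw) (free_inv (FreeGroup rw)) = free_one _ by exact: free_mulrV.
by move=> /(congr1 (@word_of _)) /= h; rewrite /reduce h.
Qed.

Lemma free_image_subgroup : subgroup free_image.
Proof.
split=> [|y z]; first by apply/mem_set; apply: (free_image_eval [::]).
by rewrite !in_setE => Fy Fz; apply: free_imageM => //; apply: free_imageV.
Qed.

Lemma free_image_rank : free_of_rank free_image k.
Proof.
pose f (w : free_group 'I_k) := word_eval w.
have fM : {morph f : u v / (u * v)%g}.
  by move=> u v; rewrite /f -word_eval_push -free_mulE.
pose phi : {multiplicative free_group 'I_k -> H} :=
  HB.pack f (isMultiplicative.Build (free_group 'I_k) H f fM).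
exists phi; split; last first.
  apply/seteqP; split=> [_ [w _ <-]|_ [w rw <-]]; first by exists w => //; apply: word_ofP.
  by exists (FreeGroup rw).
move=> u v; rewrite /phi /= => fuv; apply/divg1_eq/val_inj => /=.
have fw1 : f (u / v) = 1 by apply: (mulIg (f v)); rewrite -fM mulgVK mul1g.
have [//|w0] := eqVneq (word_of (u / v)) [::].
by case: (word_eval_neq1 (word_ofP (u / v)) w0).
Qed.

Lemma word_step : exists D, [/\ X <= D, forall a, d 1 (letter a) <= D &
  forall w t, d 1 (g ^z (tin w t)) <= D].
Proof.
pose D := X + \max_(a : 'I_k * bool) d 1 (letter a)
  + \max_(a : 'I_k * bool) d 1 (g ^z (theta a)).
exists D; split=> [|a|w t]; first by rewrite /D -addnA leq_addr.
  by apply: leq_trans (leq_bigmax (F := fun a => d 1 (letter a)) a) _; rewrite /D addnAC leq_addl.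
rewrite /tin; case: ifP => _; last by rewrite gexpz0 (hm_refl hm).
apply: leq_trans (leq_bigmax (F := fun a => d 1 (g ^z (theta a))) (nth a0 w t)) _.
by rewrite /D leq_addl.
Qed.

Lemma word_eval_lip D : (forall a, d 1 (letter a) <= D) ->
  forall w, d 1 (word_eval w) <= size w * D.
Proof.
move=> HD; elim=> [|a w IHw] /=; first by rewrite (hm_refl hm).
apply: leq_trans (hm_tri hm (letter a) _ _) _.
by rewrite (hm_mulr hm) mulSn leq_add.
Qed.

(** The lines of [w] from 1 and of [w'] from [y] have close ends, so they share a vertex and an
    exponent. The exponent identifies a letter, and cancelling its power of [g] leaves a common
    point of [F] and [y F]. *)
Lemma free_image_conj y w w' : reduced w -> reduced w' ->
  word_eval w * y = y * word_eval w' ->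
  2 * (d 1 y + 2 * X + B + 4 * X + 4 * dl) + 10 < size w -> free_image y.
Proof.
move=> rw rw' e big; have w0 : w != [::] by apply/eqP => w0; rewrite w0 ltn0 in big.
have w'0 : w' != [::].
  apply/eqP => w'0; apply: (word_eval_neq1 rw w0).
  by apply: (mulIg y); rewrite e w'0 mulg1 mul1g.
have vl := word_line_broken 1 rw w0; have vl' := word_line_broken y rw' w'0.
have [|||t [s [t0 tn s0 sn [vts ets]]]] :=
    broken_line_match ap vl vl' (A := d 1 y + 2 * X).
- rewrite /= mul1g; apply: leq_trans (hm_tri hm 1 _ _) _.
  rewrite (hm_sym hm x^-1) (hm_inv hm) mul2n -addnn addnCA leq_add2l.
  by apply: leq_trans (hm_tri hm y _ _) _; rewrite (hm_mulr hm) (hm_inv hm).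
- by rewrite !word_line_end mul1g -e (hm_mulr hm); lia.
- by lia.
(* The match is away from the ends of both words, where an exponent would come from a single
   letter. *)
case: t t0 tn vts ets => // t _ tn; case: s s0 sn => // s _ sn vts ets.
have [tn' sn'] : t.+1 < size w /\ s.+1 < size w' by lia.
have ab : nth a0 w t.+1 != inv_letter (nth a0 w t).
  by move: rw => /(sortedP a0)/(_ t tn').
have th : nth a0 w t.+1 = nth a0 w' s.+1.
  by apply: (theta_sidon ab); move: ets; rewrite /word_exp /tin /tout tn' sn'; apply.
move: vts; rewrite /= /tin tn' sn' th => /mulIg; rewrite mul1g => eq.
have -> : y = word_eval (take t.+1 w) / word_eval (take s.+1 w') by rewrite eq mulgK.
by apply: free_imageM; [|apply: free_imageV]; apply: free_image_eval.
Qed.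

Lemma free_image_malnormal : malnormal free_image.
Proof.
move=> y nFy; apply/seteqP; split=> [z [[f [w rw wf] fz]]|_ ->]; last first.
  split; last exact: (free_image_eval [::]).
  by exists 1; [exact: (free_image_eval [::])|rewrite conj1g].
move=> Fz; apply: contrapT => z1; apply: nFy.
have f1 : f <> 1 by move=> f1; apply: z1; rewrite -fz f1 conj1g.
have [D [_ HD _]] := word_step.
(* A high power of [f] is the value of a word with more than [A] letters only, as each letter moves
   1 by at most [D]. *)
pose A := 2 * (d 1 y + 2 * X + B + 4 * X + 4 * dl) + 10.
have [N HN] := expg_unbounded hm (A * D) (torsion_free_expg_inj tf f1).
have FX u : free_image u -> free_image (u ^+ N).
  move=> Fu; elim: N {HN} => [|N IHN]; first exact: (free_image_eval [::]).
  by rewrite expgS; apply: free_imageM.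
have [|w1 rw1 w1f] := FX f; first by exists w.
have [w2 rw2 w2z] := FX _ Fz.
apply: (free_image_conj rw1 rw2); rewrite ?w1f ?w2z.
  by rewrite -fz -conjXg conjgC.
rewrite -/A ltnNge; apply/negP => le; move: HN; apply/negP; rewrite -leqNgt -w1f.
by apply: leq_trans (word_eval_lip HD w1) _; rewrite leq_mul2r le orbT.
Qed.

Lemma free_image_coarsely_convex : coarsely_convex d free_image.
Proof.
have [D [XD HD tD]] := word_step.
exists (B + 8 * D + 2 * dl) => f f' r Ff Ff' rff'.
have [rlt|] := ltnP r (d f f'); last first.
  by move=> le; exists f'; split=> //; rewrite /btw ?(hm_refl hm); lia.
have [w rw wff'] := free_imageM (free_imageV Ff) Ff'.
have w0 : w != [::].
  apply/eqP => w0; move: rlt; suff -> : f = f' by rewrite (hm_refl hm).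
  by apply: (mulgI f^-1); rewrite mulVg -wff' w0.
have fw : f * word_eval w = f' by rewrite wff' mulVKg.
pose p t := f * word_eval (take t w).
(* The point of [F] sought is the value of the prefix at which the distance from [f] passes [r]. *)
have [||i iw /andP[r1 r2]] := @nat_ivt (fun t => d f (p t)) r (size w).
- by rewrite /p take0 mulg1 (hm_refl hm).
- by rewrite /p take_size fw.
exists (p i).
have step : d (p i) (p i.+1) <= D.
  rewrite /p (take_nth a0 iw) -cats1 word_eval_cat mulgA (hm_mulr hm) /= mulg1.
  exact: HD.
have vl := word_line_broken f rw w0.
have := broken_line_on ap vl (t := i.+1) (ltnW iw); rewrite word_line_end fw.
have : d (word_line f w i.+1) (p i) <= D by rewrite (hm_sym hm) (hm_mulr hm).
move=> /(btw_move hm)/[apply]; rewrite /btw.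
have : d (word_line f w 0) f = X by rewrite (hm_sym hm) (hm_mulr hm) (hm_inv hm).
have := hm_tri hm (word_line f w 0) f (p i).
have := hm_tri hm f (word_line f w 0) f'.
have := hm_tri hm (p i) f (p i.+1).
rewrite (hm_sym hm f (word_line f w 0)).
split; [|lia..].
exact: free_imageM Ff (free_image_eval _).
Qed.

End FreeSubgroup.

(** * Quasi-geodesics near coarsely convex subsets *)

Lemma last_true (P : pred nat) m : P 0 -> ~~ P m ->
  exists i, [/\ i < m, P i & forall j, i < j -> j <= m -> ~~ P j].
Proof.
move=> P0; elim: m => [|m IHm] Pm; first by rewrite P0 in Pm.
have [Pm'|/IHm[i [im Pi Pj]]] := boolP (P m).
  by exists m; split=> // j mj jm; have -> : j = m.+1 by lia.
exists i; split=> // [|j ij]; first exact: leqW.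
by rewrite leq_eqVlt => /orP[/eqP->//|]; apply: Pj.
Qed.

Section QuasiGeodesics.
Variables (H : groupType) (d : H -> H -> nat) (dl : nat) (F : set H).
Hypothesis hm : hyperbolic_metric d dl.
Hypothesis F1 : F 1.
Hypothesis Fcc : coarsely_convex d F.

Definition nearest z f := F f /\ forall f', F f' -> d z f <= d z f'.

Lemma nearest_exists z : exists f, nearest z f.
Proof.
have ex : exists n, `[< exists2 f, F f & d z f = n >].
  by exists (d z 1); apply/asboolP; exists 1.
case: (ex_minnP ex) => n /asboolP[f Ff fn] min; exists f; split=> // f' Ff'.
by rewrite fn; apply/min/asboolP; exists f'.
Qed.

(** Going from a point to any point of [F] nearly passes through its projection. If the projections
    were far apart, [z] and [z'] would be farther apart than [z] is from [F]. *)
Lemma nearest_contract : exists c, forall z z' f f',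
  nearest z f -> nearest z' f' -> d z z' <= d z f -> d f f' <= c.
Proof.
have [D HD] := Fcc.
have proj z f f' : nearest z f -> F f' -> btw d (6 * D + 4 * dl + 2) z f f'.
  move=> [Ff zf] Ff'.
  have [small|big] := leqP (d f f') (2 * D + dl).
    by rewrite /btw; have := hm_tri hm f' z f; rewrite (hm_sym hm f' f); lia.
  (* At this distance from [f], the term [d z f + d p f'] of the maximum is excluded because [p] is
     no closer to [z] than [f]; the other term gives the bound. *)
  have [p [Fp p1 p2 p3]] := HD f f' (2 * D + dl + 1) Ff Ff' ltac:(lia).
  have := zf _ Fp; move: p3; rewrite /btw.
  have := hm_hyp hm z f p f'; lia.
exists (12 * D + 9 * dl + 4) => z z' f f' nf nf' zz'.
have := proj _ _ _ nf nf'.1; have := proj _ _ _ nf' nf.1; rewrite /btw.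
have := hm_hyp hm z f f' z'.
rewrite (hm_sym hm f' f) (hm_sym hm z' f') (hm_sym hm z' f); lia.
Qed.

(* While a path stays farther than [R] from [F], it has to travel a distance [R]
   for its projection to [F] to move by [c]; for [R] large this is too slow for a
   quasi-geodesic, so its excursions have bounded length. *)
Lemma quasigeodesic_near mu la : exists R, forall (q : nat -> H) n,
  F (q 0) -> F (q n) -> (forall i, i < n -> d (q i) (q i.+1) <= mu) ->
  (forall i j, i <= j -> j <= n -> j - i <= la * d (q i) (q j)) ->
  forall m, m <= n -> exists2 f, F f & d (q m) f <= R.
Proof.
have [c Hc] := nearest_contract.
have [pr Hpr] := choice nearest_exists.
(* Outside the [R]-neighbourhood of [F], a window of [w] steps moves the projection by at most [c];
   [w] exceeds [2 * la * c] so that this rate is absorbed below. *)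
have [w Hw] : exists w : nat, w = (2 * la * c).+1 by eexists.
have [R HR] : exists R, R = (mu * w)%N by eexists.
exists (R + mu + mu * (4 * la * (R + mu) + 2 * la * c)) => q n F0 Fn qmu qla m mn.
exists (pr (q m)); first by case: (Hpr (q m)).
pose rho i := d (q i) (pr (q i)).
have rhoF i : F (q i) -> rho i <= R.
  by move=> Fi; have := (Hpr (q i)).2 _ Fi; rewrite (hm_refl hm) leqn0 /rho => /eqP->.
have [|far] := leqP (rho m) R; first by rewrite /rho; lia.
have lip i l : i + l <= n -> d (q i) (q (i + l)) <= mu * l.
  elim: l => [|l IHl] iln; first by rewrite addn0 (hm_refl hm).
  rewrite addnS in iln *; apply: leq_trans (hm_tri hm (q (i + l)) _ _) _.
  by rewrite mulnS addnC leq_add ?qmu ?IHl // ltnW.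
(* [i0] is the last index before [m], and [n - j1] the first after it, at which the path is within
   [R] of [F]. *)
have [i0 [i0m Ri0 above_l]] := @last_true (fun i => rho i <= R) m (rhoF _ F0) ltac:(lia).
have [|j1 [j1m Rj1 above_r]] :=
    @last_true (fun i => rho (n - i) <= R) (n - m) _ ltac:(rewrite /= subKn //; lia).
  by rewrite subn0; apply: rhoF.
have above i : i0 < i -> i < n - j1 -> R < rho i.
  move=> i0i ij1; rewrite ltnNge; have [im|mi] := leqP i m; first exact: above_l.
  by have := above_r (n - i); rewrite subKn; [apply; lia|lia].
pose a := i0.+1; pose b := (n - j1).-1.
have rho_lip i i' : rho i' <= d (q i') (q i) + rho i.
  apply: leq_trans ((Hpr (q i')).2 _ (Hpr (q i)).1) _; exact: hm_tri hm _ _ _.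
have rho_a : rho a <= R + mu.
  apply: leq_trans (rho_lip i0 a) _; rewrite (hm_sym hm) addnC leq_add // qmu; lia.
have rho_b : rho b <= R + mu.
  apply: leq_trans (rho_lip b.+1 b) _; rewrite addnC leq_add ?qmu //; last by rewrite /b; lia.
  by have -> : b.+1 = n - j1 by rewrite /b; lia.
have proj l : forall i, a <= i -> i + l <= b ->
    d (pr (q i)) (pr (q (i + l))) * w <= (l + w) * c.
  elim/ltn_ind: l => l IHl i ai ilb.
  have short l' : l' <= w -> i + l' <= b -> d (pr (q i)) (pr (q (i + l'))) <= c.
    move=> l'w il'b; apply: (Hc _ _ _ _ (Hpr (q i)) (Hpr (q (i + l')))).
    apply: leq_trans (lip _ _ _) _; first by rewrite /b in il'b; lia.
    apply/ltnW/(leq_ltn_trans _ (above i _ _)); [|lia|rewrite /b in il'b; lia].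
    by rewrite HR leq_mul2l l'w orbT.
  have [lw|wl] := leqP l w.
    by rewrite mulnC leq_mul ?short // leq_addl.
  have := IHl (l - w) ltac:(lia) (i + w) ltac:(lia) ltac:(lia).
  have -> : i + w + (l - w) = i + l by lia.
  have := short w (leqnn _) ltac:(lia).
  have := hm_tri hm (pr (q (i + w))) (pr (q i)) (pr (q (i + l))).
  have -> : l - w + w = l by lia.
  set u := d _ (pr (q (i + l))); set u1 := d _ (pr (q (i + w))).
  set u2 := d _ (pr (q (i + l))); nia.
have abm : a <= m <= b by rewrite /a /b; lia.
pose l := b - a.
have labn : a + l = b by rewrite /l; lia.
have bn : b <= n by rewrite /b; lia.
(* The excursion has at most [la] times the distance of its ends as steps, and this distance is at
   most [2 * (R + mu)] plus the displacement of the projection. *)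
have l_bound : l <= 4 * la * (R + mu) + 2 * la * c.
  have := proj l a (leqnn _); rewrite labn => /(_ (leqnn _)).
  have := qla a b ltac:(lia) bn; rewrite -/l.
  have := hm_tri hm (pr (q a)) (q a) (q b).
  have := hm_tri hm (pr (q b)) (pr (q a)) (q b).
  rewrite (hm_sym hm (pr (q b)) (q b)) -/(rho a) -/(rho b).
  move: rho_a rho_b; set u := d (pr _) (pr _); set v := d (q a) (q b).
  set v' := d (pr (q a)) (q b) => ra rb v'u vv' lv uw.
  have {v'u vv' ra rb v'} vu : v <= 2 * (R + mu) + u by lia.
  have lu : l <= la * (2 * (R + mu) + u) by apply: leq_trans lv _; rewrite leq_mul2l vu orbT.
  rewrite -(leq_pmul2r (m := w)); last by rewrite Hw.
  have h1 : l * w <= la * (2 * (R + mu)) * w + la * ((l + w) * c).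
    apply: leq_trans (_ : la * (2 * (R + mu) + u) * w <= _); first by rewrite leq_mul2r lu orbT.
    by rewrite mulnDr mulnDl leq_add2l -mulnA leq_mul2l uw orbT.
  have h2 : 2 * (la * c * l) <= w * l by rewrite Hw; lia.
  lia.
have := rho_lip a m; rewrite -/(rho m) (hm_sym hm (q m)).
have := lip a (m - a); rewrite subnKC; last by lia.
have : mu * (m - a) <= mu * (4 * la * (R + mu) + 2 * la * c).
  by rewrite leq_mul2l; apply/orP; right; lia.
lia.
Qed.

End QuasiGeodesics.

(** The two word metrics are Lipschitz equivalent, so geodesics for [T] are quasi-geodesics for
    [S]. *)
Lemma coarsely_convex_quasiconvex (H : groupType) (S : seq H) dl (F : set H) :
  generating S -> hyperbolic_metric (word_dist S) dl -> F 1 ->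
  coarsely_convex (word_dist S) F -> quasiconvex F.
Proof.
move=> genS hm F1 Fcc T genT.
have [la Hla] := word_lipschitz genS genT.
have [mu Hmu] := word_lipschitz genT genS.
have [R HR] := quasigeodesic_near hm F1 Fcc mu la.
exists (la * R)%N => x y p Fx Fy gp z zp.
pose q i := nth x (x :: p) i.
have [[pp lp] sp] := gp.
have q0 : q 0 = x by [].
have qn : q (size p) = y by rewrite /q -[size p]/(size (x :: p)).-1 nth_last.
have step i : i < size p -> word_dist S (q i) (q i.+1) <= mu.
  move=> ip; apply: leq_trans (Hmu _ _) _; rewrite -[leqRHS]muln1 leq_mul2l.
  apply/orP; right; apply: (@word_dist_le _ _ _ _ [:: q i.+1]).
  by split=> //=; rewrite andbT; apply: (pathP x pp).
have far i j : i <= j -> j <= size p -> j - i <= la * word_dist S (q i) (q j).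
  move=> ij jp; apply: leq_trans (Hla _ _).
  have [di _] := geodesic_nth genT gp (leq_trans ij jp).
  have [dj _] := geodesic_nth genT gp jp.
  by have := word_dist_tri genT (q i) x (q j); rewrite /q di dj; lia.
rewrite -q0 in Fx; rewrite -qn in Fy.
have zn : index z (x :: p) <= size p by rewrite -ltnS -[(size p).+1]/(size (x :: p)) index_mem.
have [f Ff] := HR q (size p) Fx Fy step far _ zn.
rewrite /q nth_index // => zf; exists f => //.
by apply: leq_trans (Hla _ _) _; rewrite leq_mul2l zf orbT.
Qed.

(** * Choice of [g] and [x], and conclusion *)

Lemma non_elementary_nontrivial (H : groupType) :
  non_elementary H -> exists h : H, h <> 1.
Proof.
move=> ne; apply: contrapT => all1; apply: ne.
have triv (h : H) : h = 1 by apply: contrapT => h1; apply: all1; exists h.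
exists (generated [set (1 : H)]%classic); split; first by exists 1.
apply: (@sub_finite_set _ _ [set [set (1 * c)%g | c in generated [set (1 : H)]]]%classic).
  by move=> _ [h _ <-]; rewrite (triv h).
exact: finite_set1.
Qed.

Lemma axis_pair_exists (H : groupType) (S : seq H) dl :
  hyperbolic_metric (word_dist S) dl -> torsion_free H -> non_elementary H ->
  exists g x C B L, axis_pair (word_dist S) dl g x C B L.
Proof.
move=> hm tf ne; have [h h1] := non_elementary_nontrivial ne.
(* [9 * dl] is the turning constant [7 * dl] plus the [2 * dl] that the local-to-global principle
   requires. *)
have [g gL gC] := loxodromic_exists hm (9 * dl) (torsion_free_expg_inj tf h1).
have {}gL : 7 * dl + 2 * dl < word_dist S 1 g by lia.
have [x xE] : exists x, ~ elem_closure g x.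
  apply: contrapT => no; apply: ne.
  apply: (virtually_cyclic_elem_closure hm gC gL) => y.
  by apply: contrapT => yE; apply: no; exists y.
have [B HB] := overlap_bound hm gC gL.
by exists g, x, (7 * dl)%N, B, (10 * (B + 4 * word_dist S 1 x + 8 * dl)).+1%N.
Qed.

Theorem lemma6p7 (H : groupType) (k : nat) :
  hyperbolic_group H -> torsion_free H -> non_elementary H -> 2 <= k ->
  exists F : set H,
    [/\ subgroup F, malnormal F, quasiconvex F & free_of_rank F k].
Proof.
move=> [S [genS hyp]] tf ne k2.
have [dl hm] := word_hyperbolic genS hyp.
have [g [x [C [B [L ap]]]]] := axis_pair_exists hm tf ne.
have a0 : 'I_k * bool by split; [exists 0; apply: ltnW|exact: true].
have sF := free_image_subgroup (word_dist S) g x L k.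
exists (free_image (word_dist S) g x L k); split.
- exact: sF.
- exact: (free_image_malnormal ap a0).
- apply: (coarsely_convex_quasiconvex genS hm).
    by have [/set_mem] := sF.
  exact: (free_image_coarsely_convex ap a0).
- exact: (free_image_rank ap a0).
Qed.
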